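(* Let $S\in\Omega_p$ be a price path, let $\pi$ be a portfolio for $S$, and let $\mu$ be the market portfolio, $\mu^i=S^i/(S^1+\cdots+S^d)$. Then the relative wealth $V^\pi=W^\pi/W^\mu$ satisfies $$\log V^\pi_t=\int_0^t\frac{\pi_s}{\mu_s}\,\mathrm{d}\mu_s-\frac12\sum_{i,j=1}^d\int_0^t\pi^i_s\pi^j_s\,\tau^\mu_{ij}(\mathrm{d}s),\qquad t\in[0,\infty),$$ where $\int_0^t\frac{\pi_s}{\mu_s}\mathrm{d}\mu_s$ is the integral of the $S$-controlled path $\pi/\mu$ against the $S$-controlled path $\mu$.
   Context: Parameters: $p\in(2,3)$, $q\ge p$, $r>1$ with $2/p+1/q>1$ and $1/r=1/p+1/q$. Notation: $\Delta_{[0,T]}=\{(s,t)\in[0,T]^2:s\le t\}$; $S_{s,t}:=S_t-S_s$; for a path or two-parameter function $A$ and $a\ge1$, $\|A\|_{a,[s,t]}:=\sup_{\mathcal{P}}(\sum_{[u,v]\in\mathcal{P}}|A_{u,v}|^a)^{1/a}$ over finite partitions of $[s,t]$. A control function is $c\colon\Delta_{[0,T]}\to[0,\infty)$ with $c(s,u)+c(u,t)\le c(s,t)$. Convention $0/0:=0$. Products and quotients of vectors such as $\pi/S$, $\pi/\mu$ are componentwise; $F_sG_{s,t}$ inside integrals is the Euclidean inner product. $\mathbb{R}_+=(0,\infty)$; $\Delta^d=\{x\in\mathbb{R}^d:\sum_ix^i=1\}$. Property (RIE): $S\in C([0,T];\mathbb{R}^d)$ satisfies (RIE) with respect to $p$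 and partitions $\mathcal{P}^n=\{0=t^n_0<\cdots<t^n_{N_n}=T\}$ with $|\mathcal{P}^n|\to0$ if, with $S^n_t:=S_T\mathbf{1}_{\{T\}}(t)+\sum_kS_{t^n_k}\mathbf{1}_{[t^n_k,t^n_{k+1})}(t)$, (1) $\int_0^tS^n_u\otimes\mathrm{d}S_u:=\sum_kS_{t^n_k}\otimes S_{t^n_k\wedge t,t^n_{k+1}\wedge t}$ converge uniformly in $t$ to a limit $\int_0^tS_u\otimes\mathrm{d}S_u$, and (2) there is a control function $c$ with $\sup_{(s,t)}\frac{|S_{s,t}|^p}{c(s,t)}+\sup_n\sup_{0\le k<\ell\le N_n}\frac{|\int_{t^n_k}^{t^n_\ell}S^n_u\otimes\mathrm{d}S_u-S_{t^n_k}\otimes S_{t^n_k,t^n_\ell}|^{p/2}}{c(t^n_k,t^n_\ell)}\le1$. The associated $p$-rough path is $\mathbf{S}=(S,\mathbb{S})$, $\mathbb{S}_{s,t}:=\int_s^tS_u\otimes\mathrm{d}S_u-S_s\otimes S_{s,t}$, and its bracket is $[\mathbf{S}]_t:=S_{0,t}\otimes S_{0,t}-2\,\mathrm{Sym}(\mathbb{S}_{0,t})$, which has finite variation. Price paths: a partition of $[0,\infty)$ is a strictly increasing sequence $0=t_0<t_1<\dots\to\infty$; $\mathcal{P}([0,T]):=(\mathcal{P}\cup\{T\})\cap[0,T]$. $\Omega_p$ is the set of $S\in C([0,\infty);\mathbb{R}^d_+)$ for which there is a sequence $(\mathcal{P}^n_S)_n$ of partitions of $[0,\infty)$ with vanishing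 mesh on compacts such that, for all $T>0$, $S|_{[0,T]}$ satisfies (RIE) with respect to $p$ and $(\mathcal{P}^n_S([0,T]))_n$. Controlled paths: $(F,F')\in\mathcal{V}^q_S$ on $[0,T]$ if $F\colon[0,T]\to\mathbb{R}^d$, $F'\colon[0,T]\to\mathcal{L}(\mathbb{R}^d;\mathbb{R}^d)$ are continuous, $\|F'\|_{q,[0,T]}<\infty$, and $R^F_{s,t}:=F_{s,t}-F'_sS_{s,t}$ has $\|R^F\|_{r,[0,T]}<\infty$. Smooth functions $f(S)$ are controlled with derivative $\mathrm{D}f(S)$; componentwise products $FG$ of controlled paths are controlled with $((FG)')^{ij}=(F')^{ij}G^i+F^i(G')^{ij}$. Integrals: $\int_0^tF_u\,\mathrm{d}\mathbf{S}_u:=\lim_{|\mathcal{P}|\to0}\sum_{[s,v]\in\mathcal{P}}(F_sS_{s,v}+\sum_{i,j}(F'_s)^{ij}\mathbb{S}^{ji}_{s,v})$ and, for controlled $F,G$, $\int_0^tF_u\,\mathrm{d}G_u:=\lim_{|\mathcal{P}|\to0}\sum_{[s,v]\in\mathcal{P}}(F_sG_{s,v}+\sum_{i,j,k}(F'_s)^{ij}(G'_s)^{ik}\mathbb{S}^{jk}_{s,v})$, over partitions of $[0,t]$. (Under (RIE) the integrals below do not depend on the choice of Gubinelli derivative $\pi'$.) Portfolios and wealth: a portfolio for $S$ is a path $\pi\colon[0,\infty)\to\Delta^d$ such that for every $T>0$ there is $\pi'\colon[0,T]\to\mathcal{L}(\mathbb{R}^d;\mathbb{R}^d)$ with $(\pi|_{[0,T]},\pi')\in\mathcal{V}^q_S$.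 Its wealth process (unit initial wealth) is $W^\pi_t:=\exp\big(\int_0^t\frac{\pi_s}{S_s}\mathrm{d}\mathbf{S}_s-\frac12\sum_{i,j}\int_0^t\frac{\pi^i_s\pi^j_s}{S^i_sS^j_s}\mathrm{d}[\mathbf{S}]^{ij}_s\big)$. The market portfolio $\mu$ is a portfolio for $S$. Covariances: $a^{ij}(\mathrm{d}s):=\frac{1}{S^i_sS^j_s}\mathrm{d}[\mathbf{S}]^{ij}_s$, and for a portfolio $\pi$, $\tau^\pi_{ij}(\mathrm{d}s):=(\pi_s-e_i)^\top a(\mathrm{d}s)(\pi_s-e_j)$, with $(e_i)$ the canonical basis of $\mathbb{R}^d$; $\tau^\mu_{ij}$ is the case $\pi=\mu$. *)

(* Defs.v *)
From HB Require Import structures.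
From mathcomp Require Import all_boot all_order all_algebra.
From mathcomp Require Import finmap.
From mathcomp Require Import all_classical all_reals all_analysis.

Set Implicit Arguments.
Unset Strict Implicit.
Unset Printing Implicit Defensive.

Import Order.TTheory GRing.Theory Num.Theory.
Import numFieldNormedType.Exports.

Local Open Scope classical_set_scope.
Local Open Scope ring_scope.

(* Vectors are row vectors.  A partition {a = t_0 < ... < t_N = b} of [a, b]
   is encoded, as in the library's [itv_partition a b l], by the list
   l = [:: t_1; ...; t_N] of its points other than a.  Paths are functions on
   the whole of R of which only the values on [0, T], or on [0, +oo[, are
   used. *)

Section Partitions.
Variable R : realType.
Implicit Types (a b T : R) (l : seq R) (P : nat -> R).

(* Sum of A u v over the intervals [u, v] of the partition a :: l. *)
Definition psum (V : nmodType) (A : R -> R -> V) a l : V :=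
  \sum_(x <- pairmap A a l) x.

Definition mesh a l : R :=
  \big[Num.max/0]_(x <- pairmap (fun u v => v - u) a l) x.

(* The filter |P| -> 0 on the partitions of [a, b].  For a = b, the only
   partition is the trivial one, encoded by [::]. *)
Definition mesh_to0 a b : set_system (seq R) :=
  filter_from [set e : R | 0 < e]
    (fun e => [set l | itv_partition a b l /\ mesh a l < e]).

Definition partition_infty P : Prop :=
  [/\ P 0%N = 0, {homo P : m n / (m < n)%N >-> m < n} & P @ \oo --> +oo].

(* (P `|` {T}) `&` [0, T], without the point 0. *)
Definition restrict_part P T : seq R :=
  sort <=%R (fset_set ((range P `|` [set T]) `&` `]0, T])).

Definition is_control T (c : R -> R -> R) : Prop :=
  (forall s t, 0 <= s -> s <= t -> t <= T -> 0 <= c s t) /\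
  (forall s u t, 0 <= s -> s <= u -> u <= t -> t <= T ->
     c s u + c u t <= c s t).

End Partitions.

Section Paths.
Variable R : realType.

Definition enorm m n (A : 'M[R]_(m, n)) : R :=
  Num.sqrt (\sum_i \sum_j A i j ^+ 2).

Definition incr (V : zmodType) (F : R -> V) (s t : R) : V := F t - F s.

Definition pvar m n (a : R) (A : R -> R -> 'M[R]_(m, n)) (s t : R) : \bar R :=
  ereal_sup [set ((psum (fun u v => enorm (A u v) `^ a) s l) `^ a^-1)%:E
            | l in [set l | itv_partition s t l]].

Definition dotp d (x y : 'rV[R]_d) : R := \sum_i x 0 i * y 0 i.

Definition tensor d (x y : 'rV[R]_d) : 'M[R]_d := x^T *m y.

Definition symmx d (A : 'M[R]_d) : 'M[R]_d := 2^-1 *: (A + A^T).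

Definition cmul d (x y : 'rV[R]_d) : 'rV[R]_d := \row_i (x 0 i * y 0 i).

Definition cinv d (x : 'rV[R]_d) : 'rV[R]_d := \row_i (x 0 i)^-1.

(* The library's jacobian acts on row vectors from the right, so that its
   (j, i) entry is the j-th partial derivative of the i-th component. *)
Definition Dmx d (f : 'rV[R]_d -> 'rV[R]_d) (x : 'rV[R]_d) : 'M[R]_d :=
  ('J f x)^T.

Definition hyperplane d : set 'rV[R]_d := [set x | \sum_i x 0 i = 1].

Definition market d (x : 'rV[R]_d) : 'rV[R]_d := (\sum_i x 0 i)^-1 *: x.

(* Riemann-Stieltjes integral over [0, t]. *)
Definition rs_int (f g : R -> R) (t : R) : R :=
  lim (psum (fun s v => f s * incr g s v) 0 @ mesh_to0 0 t).

End Paths.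

Section RIE.
Variables (R : realType) (d : nat).
Implicit Types (S : R -> 'rV[R]_d) (Q : nat -> seq R) (l : seq R).

(* \int_0^t S^n_u (x) dS_u for the partition 0 :: l. *)
Definition ito_sum S l (t : R) : 'M[R]_d :=
  psum (fun u v => tensor (S u) (incr S (Num.min u t) (Num.min v t))) 0 l.

(* In extended reals 0 / 0 = 0 and x / 0 = +oo for x > 0. *)
Definition eratio (x c : R) : \bar R := (x%:E / c%:E)%E.

Definition RIE_path (p T : R) S (c : R -> R -> R) : \bar R :=
  ereal_sup [set z | exists s t, [/\ 0 <= s, s <= t, t <= T &
    z = eratio (enorm (incr S s t) `^ p) (c s t)]].

Definition RIE_area (p : R) S Q (c : R -> R -> R) : \bar R :=
  ereal_sup [set z | exists n k m,
    let tk := nth 0 (0 :: Q n) k in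
    let tm := nth 0 (0 :: Q n) m in
    (k < m <= size (Q n))%N /\
    z = eratio (enorm (incr (ito_sum S (Q n)) tk tm
                       - tensor (S tk) (incr S tk tm)) `^ (p / 2)) (c tk tm)].

Definition RIE (p T : R) S Q : Prop :=
  [/\ {within `[0, T], continuous S},
      (forall n, itv_partition 0 T (Q n)),
      mesh 0 (Q n) @[n --> \oo] --> 0,
      (exists I : R -> 'M[R]_d,
         {uniform `[0, T], (fun n => ito_sum S (Q n)) @ \oo --> I}) &
      exists2 c, is_control T c &
        (RIE_path p T S c + RIE_area p S Q c <= 1%:E)%E].

Definition ito_int S Q (t : R) : 'M[R]_d :=
  lim (ito_sum S (Q n) t @[n --> \oo]).

Definition area S Q (s t : R) : 'M[R]_d :=
  incr (ito_int S Q) s t - tensor (S s) (incr S s t).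

Definition bracket S Q (t : R) : 'M[R]_d :=
  tensor (incr S 0 t) (incr S 0 t) - 2 *: symmx (area S Q 0 t).

(* S belongs to Omega_p, and P is a sequence of partitions witnessing it. *)
Definition price_path (p : R) S (P : nat -> nat -> R) : Prop :=
  [/\ {within `[0, +oo[, continuous S},
      (forall t i, 0 <= t -> 0 < S t 0 i),
      (forall n, partition_infty (P n)),
      (forall T, 0 < T -> mesh 0 (restrict_part (P n) T) @[n --> \oo] --> 0) &
      (forall T, 0 < T -> RIE p T S (fun n => restrict_part (P n) T))].

End RIE.

Section Controlled.
Variables (R : realType) (d : nat).
Implicit Types (S F G : R -> 'rV[R]_d) (DF DG : R -> 'M[R]_d).
Implicit Types (Q : nat -> seq R) (T t : R).

Definition remainder S F DF (s t : R) : 'rV[R]_d :=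
  incr F s t - incr S s t *m (DF s)^T.

Definition controlled (q r T : R) S F DF : Prop :=
  [/\ {within `[0, T], continuous F},
      {within `[0, T], continuous DF},
      (pvar q (incr DF) 0 T < +oo)%E &
      (pvar r (remainder S F DF) 0 T < +oo)%E].

(* Gubinelli derivative of the componentwise product. *)
Definition cmul' F DF G DG (s : R) : 'M[R]_d :=
  \matrix_(i, j) (DF s i j * G s 0 i + F s 0 i * DG s i j).

(* Gubinelli derivative of F / f(S), for f smooth with nonzero components. *)
Definition cdiv' S F DF (f : 'rV[R]_d -> 'rV[R]_d) : R -> 'M[R]_d :=
  cmul' F DF (fun s => cinv (f (S s))) (fun s => Dmx (fun x => cinv (f x)) (S s)).

Definition rough_int S Q F DF t : R :=
  lim (psum (fun s v => dotp (F s) (incr S s v)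
                        + \sum_i \sum_j DF s i j * area S Q s v j i) 0
       @ mesh_to0 0 t).

Definition controlled_sum S Q F DF G DG : seq R -> R :=
  psum (fun s v => dotp (F s) (incr G s v)
          + \sum_i \sum_j \sum_k DF s i j * DG s i k * area S Q s v j k) 0.

Definition controlled_int S Q F DF G DG t : R :=
  lim (controlled_sum S Q F DF G DG @ mesh_to0 0 t).

Definition portfolio (q r : R) S F : Prop :=
  (forall t, 0 <= t -> hyperplane (F t)) /\
  (forall T, 0 < T -> exists DF, controlled q r T S F DF).

Definition wealth S Q F DF t : R :=
  expR (rough_int S Q (fun s => cmul (F s) (cinv (S s))) (cdiv' S F DF id) t
        - 2^-1 * \sum_i \sum_j
            rs_int (fun s => F s 0 i * F s 0 j / (S s 0 i * S s 0 j))
                   (fun s => bracket S Q s i j) t).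

(* The signed measures a^{ij}(ds) and tau^F_{ij}(ds) are represented by their
   distribution functions t |-> a^{ij}([0, t]) and t |-> tau^F_{ij}([0, t]). *)
Definition cov S Q (i j : 'I_d) t : R :=
  rs_int (fun s => (S s 0 i * S s 0 j)^-1) (fun s => bracket S Q s i j) t.

Definition rel_cov S Q F (i j : 'I_d) t : R :=
  \sum_k \sum_l
    rs_int (fun s => (F s - delta_mx 0 i) 0 k * (F s - delta_mx 0 j) 0 l)
           (cov S Q k l) t.

End Controlled.

(* Main.v *)
Require Import Defs.
From mathcomp Require Import all_boot all_order all_algebra.
From mathcomp Require Import all_classical all_reals all_analysis.
From mathcomp Require Import ring lra.

Set Implicit Arguments.
Unset Strict Implicit.
Unset Printing Implicit Defensive.

Import Order.TTheory GRing.Theory Num.Theory.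
Import numFieldNormedType.Exports.

Local Open Scope classical_set_scope.
Local Open Scope ring_scope.

(** The rough integrals carry second-order terms, sums of a Gubinelli derivative
against the area of S.  The point of the proof is that these terms disappear in
the limit if one sums along the partitions P^n that define the rough path
[psum_area_null]: between two consecutive points of P^n the area is the
increment of the error ito_error of the n-th approximating integral, which
tends to zero uniformly while it keeps its 2/p-regularity, so that Young's
maximal inequality applies to an interpolation of both properties.  Along P^n,
cut at time t, all the integrals of the theorem are therefore limits of
ordinary left-point sums, whatever the Gubinelli derivatives are, and the
bracket is the limit of the sums of products of increments [rough_integral,
controlled_integral, rs_bracket_limit].

It remains to compare the summands.  Put x = S_s, h = S_{s,v}, y_i = h_i / x_i,
A = \sum_i pi_i y_i, m = \sum_i mu_i y_i.  The logarithmic wealths contribute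
A - A^2/2 and m - m^2/2; since the pi_i sum up to one, the integral of pi / mu
contributes exactly (A - m) / (1 + m), and the relative covariances contribute
(A - m)^2.  The two sides differ by (A - m) m^2 / (1 + m)
[relative_wealth_germ], a germ of order 3/p > 1, whose sums vanish.

That the integrals exist as limits over all partitions of vanishing mesh is
the sewing lemma [sewing].  A germ is a function of the endpoints s, v of an
interval.  Germs are measured by powers of control functions; since these may
jump, the definition of a small germ also asks for uniform convergence to zero
at the diagonal, which replaces the continuity of the control. *)

(** * Partitions and their sums *)

Section PartitionLists.
Variable R : realType.
Implicit Types (a b h x : R) (l m : seq R).

Section Psum.
Variable V : nmodType.
Implicit Types A B : R -> R -> V.

Lemma psum_nil A a : psum A a [::] = 0.
Proof. by rewrite /psum big_nil. Qed.

Lemma psum_cons A a x l : psum A a (x :: l) = A a x + psum A x l.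
Proof. by rewrite /psum /= big_cons. Qed.

Lemma psum_cat A a l m : psum A a (l ++ m) = psum A a l + psum A (last a l) m.
Proof.
elim: l a => [|x l IH] a; first by rewrite psum_nil add0r.
by rewrite cat_cons !psum_cons IH addrA.
Qed.

Lemma psum_rcons A a l x : psum A a (rcons l x) = psum A a l + A (last a l) x.
Proof. by rewrite -cats1 psum_cat psum_cons psum_nil addr0. Qed.

Lemma psumD A B a l :
  psum (fun u v => A u v + B u v) a l = psum A a l + psum B a l.
Proof.
elim: l a => [|x l IH] a; first by rewrite !psum_nil addr0.
by rewrite !psum_cons IH addrACA.
Qed.

Lemma psum_sum (I : finType) (A : I -> R -> R -> V) a l :
  psum (fun u v => \sum_i A i u v) a l = \sum_i psum (A i) a l.
Proof.
elim: l a => [|x l IH] a.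
  by rewrite psum_nil big1// => i _; rewrite psum_nil.
rewrite psum_cons IH -big_split/=; apply: eq_bigr => i _.
by rewrite psum_cons.
Qed.

End Psum.

Lemma psumZ k (A : R -> R -> R) a l :
  psum (fun u v => k * A u v) a l = k * psum A a l.
Proof.
elim: l a => [|x l IH] a; first by rewrite !psum_nil mulr0.
by rewrite !psum_cons IH mulrDr.
Qed.

Lemma mesh_cons a x l : mesh a (x :: l) = Num.max (x - a) (mesh x l).
Proof. by rewrite /mesh /= big_cons. Qed.

Lemma mesh_cons_lt h a x l : (mesh a (x :: l) < h) = (x - a < h) && (mesh x l < h).
Proof. by rewrite mesh_cons gt_max. Qed.

Lemma mesh_nil_lt h a : (mesh a [::] < h) = (0 < h).
Proof. by rewrite /mesh big_nil. Qed.

Lemma mesh_cat_lt h a l m : 0 < h ->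
  (mesh a (l ++ m) < h) = (mesh a l < h) && (mesh (last a l) m < h).
Proof.
move=> h0; elim: l a => [|x l IH] a; first by rewrite mesh_nil_lt h0.
by rewrite cat_cons !mesh_cons_lt IH andbA.
Qed.

Lemma itv_partition_consE a b x l :
  itv_partition a b (x :: l) <-> a < x /\ itv_partition x b l.
Proof.
by rewrite /itv_partition /=; split=> [[/andP[-> ->] ->]//|[-> [-> ->]]].
Qed.

Lemma itv_partition_catE a b l m :
  itv_partition a b (l ++ m) <->
  itv_partition a (last a l) l /\ itv_partition (last a l) b m.
Proof.
rewrite /itv_partition cat_path last_cat eqxx; split=> [[/andP[-> ->] ->]//|].
by move=> [[-> _] [-> ->]].
Qed.

Lemma itv_partition_mem a b l x : itv_partition a b l -> x \in l -> a < x <= b.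
Proof.
elim: l a => // y l IH a /itv_partition_consE[ay lP].
rewrite inE => /predU1P[->|/(IH _ lP)/andP[yx ->]].
  by rewrite ay (itv_partition_le lP).
by rewrite (lt_trans ay yx).
Qed.

(** Subdividing by steps of length h / 2 gives partitions of arbitrarily small
mesh, so that the filter of vanishing mesh is proper. *)
Lemma fine_partition a b h : a <= b -> 0 < h ->
  exists2 l, itv_partition a b l & mesh a l < h.
Proof.
move=> ab h0; have h20 : 0 < h / 2 by rewrite divr_gt0.
have [n nP] : exists n, b - a < (h / 2) *+ n.
  have ba0 : 0 <= (b - a) / (h / 2) by rewrite divr_ge0 ?subr_ge0// ltW.
  exists (Num.Def.archi_bound ((b - a) / (h / 2))).
  by rewrite -mulr_natl -ltr_pdivrMr// archi_boundP.
elim: n a ab nP => [|n IH] a ab nP.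
  by move: nP; rewrite mulr0n subr_lt0 ltNge ab.
have [->|anb] := eqVneq a b.
  by exists [::]; [split=> //=|rewrite mesh_nil_lt].
have {anb}ab' : a < b by rewrite lt_neqAle anb.
have [bah|bah] := ltP (b - a) h.
  exists [:: b]; first exact: itv_partition1.
  by rewrite mesh_cons_lt bah mesh_nil_lt.
have [||l lP lh] := IH (a + h / 2); [lra|move: nP; rewrite mulrS; lra|].
exists (a + h / 2 :: l); first by apply/itv_partition_consE; split=> //; lra.
by rewrite mesh_cons_lt lh andbT; lra.
Qed.

Lemma path_le_last a b l : path <%R a l -> b \in l -> b <= last a l.
Proof.
elim: l a => // x l IH a /= /andP[ax xl].
rewrite inE => /predU1P[->|bl]; last exact: IH.
have := mem_last x l; rewrite inE => /predU1P[->//|].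
by move: xl; rewrite lt_path_sortedE => /andP[/allP h _] /h/ltW.
Qed.

Lemma common_refinement a b l m :
  itv_partition a b l -> itv_partition a b m ->
  exists k, [/\ itv_partition a b k, {subset l <= k} & {subset m <= k}].
Proof.
move=> lP mP; exists (sort <=%R (undup (l ++ m))).
have memE x : (x \in sort <=%R (undup (l ++ m))) = (x \in l) || (x \in m).
  by rewrite mem_sort mem_undup mem_cat.
have sub x : x \in sort <=%R (undup (l ++ m)) -> a < x <= b.
  by rewrite memE => /orP[]; exact: itv_partition_mem.
split; last 2 first.
- by move=> x xl; rewrite memE xl.
- by move=> x xm; rewrite memE xm orbT.
set k := sort _ _ in memE sub *.
have ks : sorted <%R k by rewrite sort_lt_sorted undup_uniq.
split.
  by rewrite lt_path_sortedE ks andbT; apply/allP => x /sub/andP[].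
have kb : b \in a :: k.
  have : b \in a :: l by case: lP => _ /eqP <-; exact: mem_last.
  by rewrite !inE memE => /orP[->|->]; rewrite ?orbT.
have ak : path <%R a k.
  by rewrite lt_path_sortedE ks andbT; apply/allP => x /sub/andP[].
have lb : last a k <= b.
  have := mem_last a k; rewrite inE => /predU1P[->|/sub/andP[//]].
  exact: itv_partition_le lP.
rewrite eq_le lb /=.
move: kb; rewrite inE => /predU1P[->|].
  have := mem_last a k; rewrite inE => /predU1P[->//|/sub/andP[/ltW]//].
exact: path_le_last ak.
Qed.

End PartitionLists.

(** * Controls and small germs *)

Section Control.
Variables (R : realType) (T : R).
Implicit Types (w : R -> R -> R) (s t u v : R).

Lemma control_ge0 w s t : is_control T w ->
  0 <= s -> s <= t -> t <= T -> 0 <= w s t.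
Proof. by move=> [h _]; exact: h. Qed.

Lemma controlD w s u t : is_control T w ->
  0 <= s -> s <= u -> u <= t -> t <= T -> w s u + w u t <= w s t.
Proof. by move=> [_ h]; exact: h. Qed.

Lemma controlxx w s : is_control T w -> 0 <= s -> s <= T -> w s s = 0.
Proof.
move=> wc s0 sT; have := controlD wc s0 (lexx s) (lexx s) sT.
have := control_ge0 wc s0 (lexx s) sT; lra.
Qed.

Lemma control_le w s u v t : is_control T w ->
  0 <= s -> s <= u -> u <= v -> v <= t -> t <= T -> w u v <= w s t.
Proof.
move=> wc s0 su uv vt tT.
have uT : u <= T by lra. have u0 : 0 <= u by lra. have v0 : 0 <= v by lra.
have vT : v <= T by lra.
have := controlD wc s0 su (le_trans uv vt) tT.
have := controlD wc u0 uv vt tT.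
have := control_ge0 wc s0 su uT.
have := control_ge0 wc v0 vt tT; lra.
Qed.

Lemma control_add w1 w2 : is_control T w1 -> is_control T w2 ->
  is_control T (fun s t => w1 s t + w2 s t).
Proof.
move=> c1 c2; split=> [s t s0 st tT|s u t s0 su ut tT].
  by rewrite addr_ge0// control_ge0.
have := controlD c1 s0 su ut tT; have := controlD c2 s0 su ut tT; lra.
Qed.

Lemma control0 : is_control T (fun _ _ => 0).
Proof. by split=> *; rewrite ?addr0. Qed.

Lemma psum_control w (A : R -> R -> R) (e h : R) a b l :
  is_control T w -> 0 <= e ->
  (forall s t, 0 <= s -> s <= t -> t <= T -> t - s < h ->
    `|A s t| <= e * w s t) ->
  0 <= a -> b <= T -> itv_partition a b l -> mesh a l < h ->
  `|psum A a l| <= e * w a b.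
Proof.
move=> wc e0 Aw; elim: l a => [|x l IH] a a0 bT.
  move=> /itv_partition_nil ab _; rewrite psum_nil normr0 mulr_ge0//.
  by apply: (control_ge0 wc); lra.
move=> /itv_partition_consE[ax lP]; rewrite mesh_cons_lt => /andP[axh lh].
have xb := itv_partition_le lP.
rewrite psum_cons (le_trans (ler_normD _ _))//.
have h1 : `|A a x| <= e * w a x by apply: Aw => //; lra.
have x0 : 0 <= x by lra.
have h2 := IH _ x0 bT lP lh.
have h3 : e * (w a x + w x b) <= e * w a b.
  by rewrite ler_wpM2l//; apply: (controlD wc) => //; lra.
lra.
Qed.

Definition vanishing (A : R -> R -> R -> R) :=
  forall e, 0 < e -> exists2 h, 0 < h & forall s u t,
    0 <= s -> s <= u -> u <= t -> t <= T -> t - s < h -> `|A s u t| <= e.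

Definition dominated (a : R) (A : R -> R -> R -> R) :=
  exists2 w, is_control T w & exists C, forall s u t,
    0 <= s -> s <= u -> u <= t -> t <= T -> `|A s u t| <= C * w s t `^ a.

(** The controls at hand may jump, so that domination by a power of a control
does not make a function small on short intervals; the second requirement makes
up for this [small_interpolation].  The middle argument u, an intermediate point
of [s, t], is there for the defects of germs; a germ itself is regarded as a
function that ignores it. *)
Definition small a A := dominated a A /\ vanishing A.

Definition bounded3 (A : R -> R -> R -> R) :=
  exists C, forall s u t,
    0 <= s -> s <= u -> u <= t -> t <= T -> `|A s u t| <= C.

Implicit Types A B : R -> R -> R -> R.

Lemma dominated_bounded a A : 0 <= a -> dominated a A -> bounded3 A.
Proof.
move=> a0 [w wc [C AC]]; exists (`|C| * w 0 T `^ a) => s u t s0 su ut tT.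
apply: le_trans (AC _ _ _ s0 su ut tT) _.
have st := le_trans su ut.
apply: (@le_trans _ _ (`|C| * w s t `^ a)).
  by rewrite ler_wpM2r ?powR_ge0// ler_norm.
rewrite ler_wpM2l// ge0_ler_powR// ?nnegrE.
- exact: control_ge0 wc s0 st tT.
- by apply: (control_ge0 wc) => //; lra.
- exact: (control_le wc).
Qed.

Lemma vanishingD A B : vanishing A -> vanishing B ->
  vanishing (fun s u t => A s u t + B s u t).
Proof.
move=> AV BV e e0; have e20 : 0 < e / 2 by rewrite divr_gt0.
have [h h0 hA] := AV _ e20; have [k k0 kB] := BV _ e20.
exists (Num.min h k) => [|s u t s0 su ut tT]; first by rewrite lt_min h0.
rewrite lt_min => /andP[sth stk]; rewrite (le_trans (ler_normD _ _))//.
by rewrite [leRHS](splitr e) lerD// ?hA// kB.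
Qed.

Lemma vanishing_bdd A B : bounded3 A -> vanishing B ->
  vanishing (fun s u t => A s u t * B s u t).
Proof.
move=> [M AM] BV e e0; have M0 : 0 < `|M| + 1 by rewrite ltr_wpDl.
have [h h0 hB] := BV _ (divr_gt0 e0 M0); exists h => // s u t s0 su ut tT sth.
rewrite normrM (@le_trans _ _ ((`|M| + 1) * (e / (`|M| + 1))))//.
  rewrite ler_pM// ?hB// (le_trans (AM _ _ _ s0 su ut tT))//.
  by rewrite (le_trans (ler_norm M))// lerDl.
by rewrite mulrC divfK// gt_eqF.
Qed.

Lemma eq_small a A B :
  (forall s u t, 0 <= s -> s <= u -> u <= t -> t <= T -> A s u t = B s u t) ->
  small a A -> small a B.
Proof.
move=> AB [[w wc [C AC]] AV]; split.
  by exists w => //; exists C => s u t s0 su ut tT; rewrite -AB// AC.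
move=> e /AV[h h0 hA]; exists h => // s u t s0 su ut tT sth.
by rewrite -AB// hA.
Qed.

Lemma small0 a : small a (fun _ _ _ => 0).
Proof.
split; first by exists (fun _ _ => 0); [exact: control0|exists 0 => s u t *;
  rewrite normr0 mul0r].
by move=> e e0; exists 1 => // *; rewrite normr0 ltW.
Qed.

Lemma smallN a A : small a A -> small a (fun s u t => - A s u t).
Proof.
move=> [[w wc [C AC]] AV]; split.
  by exists w => //; exists C => *; rewrite normrN AC.
by move=> e /AV[h h0 hA]; exists h => // *; rewrite normrN hA.
Qed.

Lemma smallD a A B : 0 <= a -> small a A -> small a B ->
  small a (fun s u t => A s u t + B s u t).
Proof.
move=> a0 [[w wc [C AC]] AV] [[v vc [D BD]] BV]; split.
  exists (fun s t => w s t + v s t); first exact: control_add.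
  exists (`|C| + `|D|) => s u t s0 su ut tT; have st := le_trans su ut.
  have w0 := control_ge0 wc s0 st tT; have v0 := control_ge0 vc s0 st tT.
  rewrite (le_trans (ler_normD _ _))// mulrDl lerD//.
    rewrite (le_trans (AC _ _ _ s0 su ut tT))//.
    rewrite (@le_trans _ _ (`|C| * w s t `^ a))//.
      by rewrite ler_wpM2r ?powR_ge0// ler_norm.
    by rewrite ler_wpM2l// ge0_ler_powR// ?nnegrE ?lerDl// addr_ge0.
  rewrite (le_trans (BD _ _ _ s0 su ut tT))//.
  rewrite (@le_trans _ _ (`|D| * v s t `^ a))//.
    by rewrite ler_wpM2r ?powR_ge0// ler_norm.
  by rewrite ler_wpM2l// ge0_ler_powR// ?nnegrE ?lerDr// addr_ge0.
exact: vanishingD.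
Qed.

Lemma smallB a A B : 0 <= a -> small a A -> small a B ->
  small a (fun s u t => A s u t - B s u t).
Proof. by move=> a0 Aa /smallN; exact: smallD. Qed.

Lemma small_sum a (I : finType) (A : I -> R -> R -> R -> R) : 0 <= a ->
  (forall i, small a (A i)) -> small a (fun s u t => \sum_i A i s u t).
Proof.
move=> a0 Aa.
suff H (r : seq I) : small a (fun s u t => \sum_(i <- r) A i s u t) by exact: H.
elim: r => [|i r IH].
  by apply: (eq_small _ (small0 a)) => *; rewrite big_nil.
by apply: (eq_small _ (smallD a0 (Aa i) IH)) => *; rewrite big_cons.
Qed.

Lemma small_bdd a A B : bounded3 A -> small a B ->
  small a (fun s u t => A s u t * B s u t).
Proof.
move=> [M AM] [[v vc [D BD]] BV]; split.
  exists v => //; exists (`|M| * D) => s u t s0 su ut tT.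
  rewrite normrM -mulrA ler_pM// ?BD//.
  by rewrite (le_trans (AM _ _ _ s0 su ut tT))// ler_norm.
by apply: vanishing_bdd => //; exists M.
Qed.

Lemma bounded3_cst c : bounded3 (fun _ _ _ => c).
Proof. by exists `|c|. Qed.

Lemma bounded3M A B : bounded3 A -> bounded3 B ->
  bounded3 (fun s u t => A s u t * B s u t).
Proof.
move=> [C AC] [D BD]; exists (C * D) => s u t s0 su ut tT.
by rewrite normrM ler_pM// ?AC// BD.
Qed.

Lemma smallM a b A B : 0 < a -> 0 < b -> small a A -> small b B ->
  small (a + b) (fun s u t => A s u t * B s u t).
Proof.
move=> a0 b0 [[w wc [C AC]] AV] Bb; split; last first.
  have : bounded3 A by apply: (dominated_bounded (ltW a0)); exists w => //; exists C.
  by move=> /small_bdd/(_ Bb)[].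
move: Bb => [[v vc [D BD]] BV].
exists (fun s t => w s t + v s t); first exact: control_add.
exists (`|C| * `|D|) => s u t s0 su ut tT; have st := le_trans su ut.
have w0 := control_ge0 wc s0 st tT; have v0 := control_ge0 vc s0 st tT.
rewrite powRD; last by rewrite gt_eqF ?addr_gt0.
rewrite (normrM (A s u t)) mulrACA ler_pM//.
  rewrite (le_trans (AC _ _ _ s0 su ut tT))//.
  rewrite (@le_trans _ _ (`|C| * w s t `^ a))//.
    by rewrite ler_wpM2r ?powR_ge0// ler_norm.
  by rewrite ler_wpM2l// ge0_ler_powR ?nnegrE ?lerDl// ?addr_ge0// ltW.
rewrite (le_trans (BD _ _ _ s0 su ut tT))//.
rewrite (@le_trans _ _ (`|D| * v s t `^ b))//.
  by rewrite ler_wpM2r ?powR_ge0// ler_norm.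
by rewrite ler_wpM2l// ge0_ler_powR ?nnegrE ?lerDr// ?addr_ge0// ltW.
Qed.

Lemma small_le a b A : 0 < a -> a <= b -> small b A -> small a A.
Proof.
move=> a0 ab [[w wc [C AC]] AV]; split=> //.
exists w => //; exists (`|C| * w 0 T `^ (b - a)) => s u t s0 su ut tT.
have st := le_trans su ut.
have w0 := control_ge0 wc s0 st tT.
rewrite (le_trans (AC _ _ _ s0 su ut tT))//.
rewrite -[in w s t `^ b](subrK a b) powRD; last by rewrite subrK gt_eqF ?(lt_le_trans a0).
rewrite mulrA ler_wpM2r ?powR_ge0//.
rewrite (@le_trans _ _ (`|C| * w s t `^ (b - a)))//.
  by rewrite ler_wpM2r ?powR_ge0// ler_norm.
rewrite ler_wpM2l// ge0_ler_powR ?nnegrE ?subr_ge0//.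
- by apply: (control_ge0 wc) => //; lra.
- exact: (control_le wc).
Qed.

(** Controls are monotone in the interval. *)
Lemma small_left a (A : R -> R -> R) : 0 <= a ->
  small a (fun s _ t => A s t) -> small a (fun s u _ => A s u).
Proof.
move=> a0 [[w wc [C AC]] AV]; split.
  exists w => //; exists `|C| => s u t s0 su ut tT.
  have uT := le_trans ut tT.
  rewrite (le_trans (AC _ _ _ s0 (lexx s) su uT))//.
  rewrite (@le_trans _ _ (`|C| * w s u `^ a))//.
    by rewrite ler_wpM2r ?powR_ge0// ler_norm.
  rewrite ler_wpM2l// ge0_ler_powR ?nnegrE//.
  - exact: (control_ge0 wc).
  - by apply: (control_ge0 wc) => //; lra.
  - exact: (control_le wc).
move=> e /AV[h h0 hA]; exists h => // s u t s0 su ut tT sth.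
by apply: (hA s s u) => //; lra.
Qed.

Lemma small_right a (A : R -> R -> R) : 0 <= a ->
  small a (fun s _ t => A s t) -> small a (fun _ u t => A u t).
Proof.
move=> a0 [[w wc [C AC]] AV]; split.
  exists w => //; exists `|C| => s u t s0 su ut tT.
  have u0 := le_trans s0 su.
  rewrite (le_trans (AC _ _ _ u0 (lexx u) ut tT))//.
  rewrite (@le_trans _ _ (`|C| * w u t `^ a))//.
    by rewrite ler_wpM2r ?powR_ge0// ler_norm.
  rewrite ler_wpM2l// ge0_ler_powR ?nnegrE//.
  - exact: (control_ge0 wc).
  - by apply: (control_ge0 wc) => //; lra.
  - exact: (control_le wc).
move=> e /AV[h h0 hA]; exists h => // s u t s0 su ut tT sth.
by apply: (hA u u t) => //; lra.
Qed.

(** Write x as the product of x ^ (1 - b / a) and x ^ (b / a), and use one bound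
for each factor. *)
Lemma powR_interpolation (a b e M x y : R) : 0 < b -> b < a -> 0 <= M -> 0 <= x ->
  0 <= y -> x <= e -> x <= M * y `^ a ->
  x <= e `^ (1 - b / a) * (M `^ (b / a) * y `^ b).
Proof.
move=> b0 ba M0 x0 y0 xe xy; have a0 := lt_trans b0 ba.
have l0 : 0 <= b / a by rewrite divr_ge0// ltW.
have c0 : 0 <= 1 - b / a by rewrite subr_ge0 ler_pdivrMr// mul1r ltW.
have -> : x = x `^ (1 - b / a) * x `^ (b / a).
  by rewrite -powRD ?subrK ?powRr1// oner_eq0.
have -> : M `^ (b / a) * y `^ b = (M * y `^ a) `^ (b / a).
  by rewrite powRM ?powR_ge0// -powRrM [a * _]mulrCA divff ?gt_eqF// mulr1.
have e0 := le_trans x0 xe.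
apply: ler_pM; [exact: powR_ge0|exact: powR_ge0| |];
  apply: ge0_ler_powR => //; rewrite nnegrE//.
by rewrite mulr_ge0 ?powR_ge0.
Qed.

Lemma powR_root (x a : R) : 0 <= x -> a != 0 -> (x `^ a^-1) `^ a = x.
Proof. by move=> x0 a0; rewrite -powRrM mulVf// powRr1. Qed.

(** Giving up a part of the exponent buys an arbitrarily small factor on short
intervals. *)
Lemma small_interpolation a b A : 0 < b -> b < a -> small a A ->
  exists2 w, is_control T w & forall e, 0 < e ->
  exists2 h, 0 < h & forall s u t,
    0 <= s -> s <= u -> u <= t -> t <= T -> t - s < h ->
    `|A s u t| <= e * w s t `^ b.
Proof.
move=> b0 ba [[w wc [C AC]] AV]; exists w => // e e0.
have c0 : 1 - b / a != 0.
  by rewrite gt_eqF// subr_gt0 ltr_pdivrMr ?mul1r// (lt_trans b0).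
set C1 := (`|C| + 1) `^ (b / a).
have C10 : 0 < C1 by rewrite powR_gt0// ltr_wpDl.
have [h h0 hA] := AV ((e / C1) `^ (1 - b / a)^-1) (powR_gt0 _ (divr_gt0 e0 C10)).
exists h => // s u t s0 su ut tT sth; have st := le_trans su ut.
have w0 := control_ge0 wc s0 st tT.
have hC : `|A s u t| <= (`|C| + 1) * w s t `^ a.
  rewrite (le_trans (AC _ _ _ s0 su ut tT))// ler_wpM2r ?powR_ge0//.
  by rewrite (le_trans (ler_norm C))// lerDl.
have C1ge0 : 0 <= `|C| + 1 by rewrite addr_ge0.
apply: (le_trans (powR_interpolation b0 ba C1ge0 (normr_ge0 _) w0
  (hA _ _ _ s0 su ut tT sth) hC)).
rewrite powR_root ?divr_ge0 ?(ltW e0) ?(ltW C10)//.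
by rewrite mulrA divfK// gt_eqF.
Qed.

End Control.

(** * Sewing *)

Section Sewing.
Variables (R : realType) (T : R).
Implicit Types (w Xi : R -> R -> R) (s t u v a b : R) (l m : seq R).

Definition defect Xi s u t := Xi s t - Xi s u - Xi u t.

Lemma split_first (A : Type) (P : pred A) (r : seq A) : has P r ->
  exists x r1 r2, [/\ r = r1 ++ x :: r2, P x & ~~ has P r1].
Proof.
move=> h; case: (split_find h) => x r1 r2 px r1P.
by exists x, r1, r2; rewrite cat_rcons.
Qed.

(** Young's maximal inequality.  The partition is split at the interval across
which the control, measured from the left endpoint, passes half of its total
mass; the two remaining parts carry at most half of the mass each, and
2 * (1/2)^theta < 1 makes the resulting recursion contract.  The defect is
bounded at points of the partition only, because the n-th approximation of the
integral of S against itself is controlled nowhere else. *)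
Lemma young_maximal theta : 1 < theta -> exists2 K, 0 <= K &
  forall w Xi C a l, is_control T w -> 0 <= C -> 0 <= a -> last a l <= T ->
  path <%R a l ->
  (forall s u t, s \in a :: l -> u \in a :: l -> t \in a :: l ->
     s <= u -> u <= t -> `|defect Xi s u t| <= C * w s t `^ theta) ->
  `|psum Xi a l - Xi a (last a l)| <= K * C * w a (last a l) `^ theta.
Proof.
move=> th1; have th0 : 0 < theta by lra.
set r := 2 * (2^-1 : R) `^ theta.
have r1 : r < 1.
  rewrite /r -(mulr_powRB1 (_ : 0 <= (2^-1 : R)) th0) ?invr_ge0//.
  rewrite mulrA divff// mul1r.
  have := @gt0_ltr_powR _ (theta - 1) (_ : 0 < _) (2^-1 : R) 1.
  by rewrite powR1 !nnegrE; apply => //; rewrite ?subr_gt0// invf_lt1// ltr1n.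
set K := 2 / (1 - r).
have K0 : 0 <= K by rewrite divr_ge0// subr_ge0 ltW.
exists K => // w Xi C a l wc C0.
have [n] := ubnP (size l); elim: n a l => // n IH a l sln a0 lT al dX.
have [l0|l0] := eqVneq l [::].
  rewrite l0 psum_nil /= sub0r normrN; rewrite l0 /= in lT.
  have := dX a a a (mem_head _ _) (mem_head _ _) (mem_head _ _) (lexx a) (lexx a).
  by rewrite (controlxx wc)// powR0 ?gt_eqF// /defect subrr sub0r normrN !mulr0.
set b := last a l in lT *; set W := w a b.
have bl : b \in l.
  by rewrite /b; case/lastP: l l0 {sln al dX lT b W} => // l y _;
    rewrite last_rcons mem_rcons mem_head.
have ab : a <= b.
  by move: al; rewrite lt_path_sortedE => /andP[/allP/(_ _ bl)/ltW].
have W0 : 0 <= W by exact: control_ge0 wc a0 ab lT.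
have : has (fun x => (W / 2 < w a x) || (x == b)) l.
  by apply/hasP; exists b => //; rewrite eqxx orbT.
move=> /split_first[x [l1 [l2 [El Px l1P]]]].
have [al1 [l1x xl2]] : path <%R a l1 /\ last a l1 < x /\ path <%R x l2.
  by move: al; rewrite El cat_path /= => /andP[-> /andP[-> ->]].
have bE : last x l2 = b by rewrite /b El last_cat.
set u := last a l1 in l1x.
have memu : u \in a :: l.
  by rewrite El -cat_cons mem_cat mem_last.
have memx : x \in a :: l by rewrite El inE mem_cat mem_head !orbT.
have memb : b \in a :: l by rewrite inE bl orbT.
have au : a <= u.
  by case/predU1P: memu => [->//|]; move: al; rewrite lt_path_sortedE =>
    /andP[/allP h _] /h/ltW.
have xb : x <= b.
  by rewrite path_le_last// El mem_cat mem_head orbT.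
have xT := le_trans xb lT; have ux := ltW l1x; have uT := le_trans ux xT.
have x0 : 0 <= x by rewrite (le_trans a0)// (le_trans au).
have wau : w a u <= W / 2.
  have : u \in a :: l1 by exact: mem_last.
  rewrite inE => /predU1P[->|ul1].
    by rewrite (controlxx wc)// ?(le_trans ab) ?divr_ge0//.
  have /hasPn/(_ _ ul1) := l1P; by rewrite negb_or -leNgt => /andP[].
have wxb : w x b <= W / 2.
  case/orP: Px => [wax|/eqP->]; last by rewrite (controlxx wc) ?divr_ge0// (le_trans a0).
  have := controlD wc a0 (le_trans au ux) xb lT; rewrite -/W; lra.
have pw z : 0 <= z -> z <= W / 2 -> z `^ theta <= r / 2 * W `^ theta.
  move=> z0 zW; have -> : r / 2 = (2^-1) `^ theta by rewrite /r mulrAC divff// mul1r.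
  rewrite -powRM ?invr_ge0// [_ * W]mulrC ge0_ler_powR ?nnegrE ?divr_ge0//.
  exact: ltW.
have dX1 : `|psum Xi a l1 - Xi a u| <= K * C * w a u `^ theta.
  apply: IH => //; first by move: sln; rewrite El size_cat /= addnS !ltnS; apply: leq_trans; rewrite ltnS leq_addr.
  by move=> s v t s1 v1 t1; apply: dX; rewrite El -cat_cons mem_cat ?s1 ?v1 ?t1.
have dX2 : `|psum Xi x l2 - Xi x b| <= K * C * w x b `^ theta.
  rewrite -bE; apply: IH => //; rewrite ?bE//.
    by move: sln; rewrite El size_cat /= addnS !ltnS; apply: leq_trans; rewrite ltnS leq_addl.
  by move=> s v t s1 v1 t1; apply: dX; rewrite El inE mem_cat ?s1 ?v1 ?t1 !orbT.
have d1 := dX a u x (mem_head _ _) memu memx au ux.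
have d2 := dX a x b (mem_head _ _) memx memb (le_trans au ux) xb.
have d1' : `|defect Xi a u x| <= C * W `^ theta.
  rewrite (le_trans d1)// ler_wpM2l// ge0_ler_powR ?nnegrE ?(ltW th0)//.
  - by apply: (control_ge0 wc) => //; exact: le_trans ux.
  - by apply: (control_le wc) => //; exact: le_trans ux.
have -> : psum Xi a l - Xi a b = (psum Xi a l1 - Xi a u) + (psum Xi x l2 - Xi x b)
    - defect Xi a u x - defect Xi a x b.
  by rewrite El psum_cat psum_cons /defect; ring.
have pau := pw _ (control_ge0 wc a0 au uT) wau.
have pxb := pw _ (control_ge0 wc x0 xb lT) wxb.
have KC0 : 0 <= K * C by rewrite mulr_ge0.
have : K * C * w a u `^ theta <= K * C * (r / 2 * W `^ theta) by rewrite ler_wpM2l.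
have : K * C * w x b `^ theta <= K * C * (r / 2 * W `^ theta) by rewrite ler_wpM2l.
have -> : K * C * W `^ theta
    = K * C * (r / 2 * W `^ theta) + K * C * (r / 2 * W `^ theta)
      + 2 * (C * W `^ theta).
  by rewrite /K; field; lra.
move: dX1 dX2 d1' d2; rewrite -/W !ler_norml.
move: (defect _ _ _ _) (defect _ _ _ _) (psum _ _ _ - _) (psum _ _ _ - _).
move=> *; lra.
Qed.

(** The finer partition restricts to a partition of each interval of the coarser
one, and the resulting bounds add up by superadditivity. *)
Lemma psum_refine (Xi w : R -> R -> R) e h a b l m :
  is_control T w -> 0 <= e ->
  (forall s t k, 0 <= s -> s <= t -> t <= T -> t - s < h -> itv_partition s t k ->
    `|psum Xi s k - Xi s t| <= e * w s t) ->
  0 <= a -> b <= T -> itv_partition a b l -> itv_partition a b m ->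
  {subset l <= m} -> mesh a l < h ->
  `|psum Xi a m - psum Xi a l| <= e * w a b.
Proof.
move=> wc e0 H; elim: l a m => [|x l IH] a m a0 bT.
  move=> lP; have E := itv_partition_nil lP; rewrite -E in bT *.
  move=> /itv_partitionxx -> _ _; rewrite !psum_nil subrr normr0 mulr_ge0//.
  exact: (control_ge0 wc).
move=> /itv_partition_consE[ax lP] mP lm; rewrite mesh_cons_lt => /andP[xah lh].
have xb := itv_partition_le lP.
have x0 : 0 <= x by lra.
have : x \in m by rewrite lm ?mem_head.
move: mP lm => + + xm; case/splitPr: m / xm => m1 m2 mP lm.
have [m1P m2P] : itv_partition a x (rcons m1 x) /\ itv_partition x b m2.
  by move: mP; rewrite -cat_rcons => /itv_partition_catE; rewrite last_rcons.
have lm2 : {subset l <= m2}.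
  move=> y yl; have /andP[xy _] := itv_partition_mem lP yl.
  have : y \in m1 ++ x :: m2 by apply: lm; rewrite inE yl orbT.
  rewrite -cat_rcons mem_cat => /orP[|//] ym1.
  by have /andP[_] := itv_partition_mem m1P ym1; rewrite leNgt xy.
rewrite -cat_rcons psum_cat last_rcons psum_cons opprD addrACA.
rewrite (le_trans (ler_normD _ _))//.
have h1 := H a x _ a0 (ltW ax) (le_trans xb bT) xah m1P.
have h2 := IH _ _ x0 bT lP m2P lm2 lh.
have := controlD wc a0 (ltW ax) xb bT => /(ler_wpM2l e0).
lra.
Qed.

#[global] Instance mesh_to0_filter a b : Filter (mesh_to0 a b).
Proof.
apply: filter_from_filter; first by exists 1 => /=.
move=> i j i0 j0; exists (Num.min i j); first by rewrite /= lt_min i0.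
by move=> l [lP]; rewrite lt_min => /andP[li lj]; split.
Qed.

Lemma mesh_to0_proper a b : a <= b -> ProperFilter (mesh_to0 a b).
Proof.
move=> ab; apply: filter_from_proper => i i0.
by have [l lP li] := fine_partition ab i0; exists l.
Qed.

Lemma mesh_to0_cvgP (f : seq R -> R) a b (x : R) :
  f @ mesh_to0 a b --> x <->
  forall e, 0 < e -> exists2 h, 0 < h &
    forall l, itv_partition a b l -> mesh a l < h -> `|x - f l| <= e.
Proof.
split=> [/cvgrPdist_le H e /H[h h0 hP]|H].
  by exists h => // l lP lh; apply: hP.
apply/cvgrPdist_le => e /H[h h0 hP]; exists h => // l [lP lh]; exact: hP.
Qed.

Lemma control_powR_le theta w s t : 1 < theta -> is_control T w ->
  0 <= s -> s <= t -> t <= T ->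
  w s t `^ theta <= w 0 T `^ (theta - 1) * w s t.
Proof.
move=> th1 wc s0 st tT; have w0 := control_ge0 wc s0 st tT.
rewrite -(mulr_powRB1 w0) ?(lt_trans ltr01)// mulrC ler_wpM2r//.
rewrite ge0_ler_powR ?nnegrE ?subr_ge0 ?(ltW th1)//.
- by apply: (control_ge0 wc) => //; lra.
- exact: (control_le wc).
Qed.

(** The sewing lemma.  The maximal inequality, used with an exponent strictly
between 1 and theta, compares the sums along two fine partitions with the sum
along a common refinement up to an arbitrarily small multiple of a control;
hence the sums are Cauchy.  Used with theta itself, it bounds the increments of
the limit. *)
Theorem sewing theta Xi : 1 < theta -> small T theta (defect Xi) ->
  exists J : R -> R,
    (forall t, 0 <= t -> t <= T -> psum Xi 0 @ mesh_to0 0 t --> J t) /\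
    small T theta (fun s _ t => J t - J s - Xi s t).
Proof.
move=> th1 dX.
(* The exponent (1 + theta) / 2 still exceeds one and leaves room below theta
for a small factor. *)
have th01 : 1 < (1 + theta) / 2 by lra.
have th0th : (1 + theta) / 2 < theta by lra.
have [K K0 KP] := young_maximal th01.
have [v vc vP] := small_interpolation (lt_trans ltr01 th01) th0th dX.
have near_germ e : 0 < e -> exists2 h, 0 < h & forall s t k,
    0 <= s -> s <= t -> t <= T -> t - s < h -> itv_partition s t k ->
    `|psum Xi s k - Xi s t| <= e * v s t.
  move=> e0; set M := K * v 0 T `^ ((1 + theta) / 2 - 1) + 1.
  have M0 : 0 < M by rewrite ltr_wpDl// mulr_ge0// powR_ge0.
  have [h h0 hP] := vP _ (divr_gt0 e0 M0); exists h => // s t k s0 st tT sth kP.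
  have [sk /eqP kt] := kP; rewrite -kt.
  have eM0 : 0 <= e / M by rewrite divr_ge0// ltW.
  apply: le_trans (KP _ _ (e / M) _ _ vc eM0 s0 _ sk _) _; first by rewrite kt.
    move=> x y z xk yk zk xy yz.
    have bd c : c \in s :: k -> s <= c <= t.
      rewrite inE => /predU1P[->|]; first by rewrite lexx.
      by move=> /(itv_partition_mem kP)/andP[/ltW -> ->].
    have /andP[sx xt] := bd _ xk; have /andP[sz zt] := bd _ zk.
    by apply: hP => //; lra.
  rewrite kt; have v0 := control_ge0 vc s0 st tT.
  have := control_powR_le th01 vc s0 st tT.
  move=> /(ler_wpM2l (mulr_ge0 K0 eM0))/le_trans; apply.
  rewrite mulrA ler_wpM2r//.
  have -> : K * (e / M) * v 0 T `^ ((1 + theta) / 2 - 1)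
    = e * (K * v 0 T `^ ((1 + theta) / 2 - 1) / M) by field; rewrite gt_eqF.
  rewrite -[leRHS]mulr1 ler_wpM2l ?(ltW e0)// ler_pdivrMr// mul1r lerDl//.
have cvgX t : 0 <= t -> t <= T -> cvg (psum Xi 0 @ mesh_to0 0 t).
  move=> t0 tT; have PF := mesh_to0_proper t0; apply/cauchy_cvgP/cauchyP => e e0.
  set M := v 0 t + 1.
  have M0 : 0 < M by rewrite ltr_wpDl// (control_ge0 vc).
  have e20 : 0 < e / (4 * M) by rewrite divr_gt0// mulr_gt0.
  have [h h0 hP] := near_germ _ e20.
  have [l lP lh] := fine_partition t0 h0.
  exists (psum Xi 0 l); exists h => // m [mP mh].
  have [k [kP lk mk]] := common_refinement lP mP.
  have := psum_refine vc (ltW e20) hP (lexx 0) tT lP kP lk lh.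
  have := psum_refine vc (ltW e20) hP (lexx 0) tT mP kP mk mh.
  have : e / (4 * M) * v 0 t <= e / 4.
    rewrite invfM mulrA -[leRHS]mulr1 -mulrA ler_wpM2l// ?divr_ge0 ?(ltW e0)//.
    by rewrite mulrC ler_pdivrMr// mul1r lerDl.
  rewrite /ball /= !ler_norml ltr_norml => *; lra.
pose J t := lim (psum Xi 0 @ mesh_to0 0 t).
have JP t : 0 <= t -> t <= T -> psum Xi 0 @ mesh_to0 0 t --> J t.
  by move=> t0 tT; exact: cvgX.
exists J; split => //.
have incrJ s t (B : R) : 0 <= s -> s <= t -> t <= T ->
    (forall k, itv_partition s t k -> `|psum Xi s k - Xi s t| <= B) ->
    `|J t - J s - Xi s t| <= B.
  move=> s0 st tT hB; apply/ler_addgt0Pr => e e0.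
  have e20 : 0 < e / 2 by rewrite divr_gt0.
  have /mesh_to0_cvgP/(_ _ e20)[h h0 hP] := JP _ s0 (le_trans st tT).
  have /mesh_to0_cvgP/(_ _ e20)[k k0 kP] := JP _ (le_trans s0 st) tT.
  have hk0 : 0 < Num.min h k by rewrite lt_min h0.
  have [l lP] := fine_partition s0 hk0; rewrite lt_min => /andP[lh lk].
  have [m mP] := fine_partition st hk0; rewrite lt_min => /andP[mh mk].
  have ls : last 0 l = s by case: lP => _ /eqP.
  have := kP (l ++ m); rewrite psum_cat mesh_cat_lt// ls lk mk => /(_ _ isT).
  move=> /(_ (itv_partition_cat lP mP)).
  have := hP l lP lh; have := hB m mP.
  rewrite !ler_norml => *; lra.
split; last first.
  move=> e e0; set M := v 0 T + 1.
  have [T0|T0] := ltP T 0; first by exists 1 => // s u t; lra.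
  have M0 : 0 < M by rewrite ltr_wpDl// (control_ge0 vc).
  have [h h0 hP] := near_germ _ (divr_gt0 e0 M0).
  exists h => // s u t s0 su ut tT sth; have st := le_trans su ut.
  apply: incrJ => // k kP; apply: le_trans (hP _ _ _ s0 st tT sth kP) _.
  have vst : v s t <= v 0 T by exact: (control_le vc).
  rewrite mulrAC ler_pdivrMr// ler_wpM2l ?(ltW e0)//.
  by rewrite (le_trans vst)// lerDl.
have [L L0 LP] := young_maximal th1.
have [[w wc [C CP]] _] := dX.
exists w => //; exists (L * `|C|) => s u t s0 su ut tT; have st := le_trans su ut.
apply: incrJ => // k kP; have [sk /eqP kt] := kP; rewrite -kt.
apply: LP => //; first by rewrite kt.
move=> x y z xk yk zk xy yz.
have bd c : c \in s :: k -> s <= c <= t.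
  rewrite inE => /predU1P[->|]; first by rewrite lexx.
  by move=> /(itv_partition_mem kP)/andP[/ltW -> ->].
have /andP[sx xt] := bd _ xk; have /andP[sz zt] := bd _ zk.
apply: (le_trans (CP _ _ _ _ xy yz _)); [lra|lra|].
by rewrite ler_wpM2r ?powR_ge0// ler_norm.
Qed.

(** Above order one, a germ is on short intervals a small multiple of a control,
and controls are superadditive. *)
Lemma small_psum_cvg0 theta (A : R -> R -> R) t : 1 < theta ->
  small T theta (fun s _ v => A s v) -> 0 <= t -> t <= T ->
  psum A 0 @ mesh_to0 0 t --> 0.
Proof.
move=> th1 sA t0 tT; apply/mesh_to0_cvgP => e e0.
have th01 : 1 < (1 + theta) / 2 by lra.
have th0th : (1 + theta) / 2 < theta by lra.
have [v vc vP] := small_interpolation (lt_trans ltr01 th01) th0th sA.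
set M := v 0 T `^ ((1 + theta) / 2 - 1) * v 0 t + 1.
have M0 : 0 < M.
  by rewrite ltr_wpDl// mulr_ge0 ?powR_ge0// (control_ge0 vc).
have [h h0 hP] := vP _ (divr_gt0 e0 M0); exists h => // l lP lh.
rewrite sub0r normrN; have eM0 := ltW (divr_gt0 e0 M0).
set D := v 0 T `^ ((1 + theta) / 2 - 1) in M M0 hP eM0.
have AD u x : 0 <= u -> u <= x -> x <= T -> x - u < h ->
    `|A u x| <= e / M * D * v u x.
  move=> u0 ux xT uxh; apply: (le_trans (hP _ _ _ u0 (lexx u) ux xT uxh)).
  by rewrite -mulrA ler_wpM2l// control_powR_le.
have eMD0 : 0 <= e / M * D by rewrite mulr_ge0 ?powR_ge0.
apply: le_trans (psum_control vc eMD0 AD (lexx 0) tT lP lh) _.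
have -> : e / M * D * v 0 t = e * (D * v 0 t / M) by field; rewrite gt_eqF.
rewrite -[leRHS]mulr1 ler_wpM2l ?(ltW e0)// ler_pdivrMr// mul1r lerDl//.
Qed.

End Sewing.

(** * Uniform continuity on the time interval *)

Section Modulus.
Variables (R : realType) (T : R).

(** The Heine-Cantor theorem, from compactness as a near-covering property. *)
Lemma uniform_modulus (g : R -> R) : {within `[0, T], continuous g} ->
  vanishing T (fun s _ t => incr g s t).
Proof.
move=> /subspace_continuousP gc e e0.
have cpt : compact `[0, T] by exact: segment_compact.
move/compact_near_coveringP in cpt.
have e20 : 0 < e / 2 by rewrite divr_gt0.
have := cpt R 0^'+ (fun h x => 0 <= x <= T -> forall y, 0 <= y <= T -> `|y - x| < h ->
  `|g y - g x| <= e) _.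
case.
  move=> x /[dup] x0T /gc /cvgrPdist_lt/(_ _ e20).
  rewrite near_withinE => -[d /= d0 dP].
  exists (ball x (d / 2), [set h : R | h < d / 2]).
    split; first by apply: nbhsx_ballx; rewrite divr_gt0.
    by apply: nbhs_right_lt; rewrite divr_gt0.
  move=> [y h] /= [xy hd] yT z zT zy.
  have h1 := dP y.
  have h2 := dP z.
  move: xy h1 h2; rewrite /ball_ /ball /= => xy.
  move=> /(_ _ yT) h1 /(_ _ zT) h2.
  have {}h1 := h1 ltac:(lra).
  have {}h2 := h2 ltac:(move: xy zy; rewrite !ltr_norml; lra).
  rewrite (le_trans (ler_distD (g x) _ _))// (splitr e) lerD//.
    by rewrite distrC; exact: ltW h2.
  exact: ltW h1.
move=> h /= h0 hP; exists (h / 2); first by rewrite divr_gt0.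
move=> s u t s0 su ut tT sth.
have st := le_trans su ut.
apply: (hP (h / 2)).
- by rewrite /ball_ /= sub0r normrN gtr0_norm ?divr_gt0//; lra.
- by rewrite divr_gt0.
- by rewrite /= in_itv /= s0 (le_trans st).
- by rewrite s0 (le_trans st).
- by rewrite tT (le_trans s0 st).
- by rewrite ger0_norm ?subr_ge0.
Qed.

Lemma entry_continuous m n (f : R -> 'M[R]_(m, n)) i j :
  {within `[0, T], continuous f} -> {within `[0, T], continuous (fun s => f s i j)}.
Proof.
move=> /subspace_continuousP fc; apply/subspace_continuousP => x /fc fx.
have := @coord_continuous _ m n i j (f x).
by move/(cvg_comp _ _ fx).
Qed.

Lemma positive_bounded (g : R -> R) : {within `[0, T], continuous g} ->
  (forall s, 0 <= s -> s <= T -> 0 < g s) ->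
  exists2 m, 0 < m & forall s, 0 <= s -> s <= T -> m <= g s.
Proof.
move=> gc g0; have [T0|T0] := ltP T 0; first by exists 1 => // s; lra.
have [c cT cP] := EVT_min T0 gc.
exists (g c); first by move: cT; rewrite in_itv /= => /andP[]; exact: g0.
by move=> s s0 sT; apply: cP; rewrite in_itv /= s0.
Qed.

End Modulus.

(** * Controls from variation norms *)

Section Variation.
Variables (R : realType) (T : R).

Lemma entry_le_enorm m n (A : 'M[R]_(m, n)) i j : `|A i j| <= enorm A.
Proof.
rewrite /enorm -sqrtr_sqr ler_wsqrtr// (bigD1 i)//= (bigD1 j)//= -addrA lerDl.
by rewrite addr_ge0// sumr_ge0// => k _; rewrite ?sqr_ge0// sumr_ge0// => l _;
  exact: sqr_ge0.
Qed.

Lemma psum_ge0 (A : R -> R -> R) a l : (forall s t, 0 <= A s t) -> 0 <= psum A a l.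
Proof.
by move=> A0; elim: l a => [|x l IH] a; rewrite ?psum_nil ?psum_cons ?addr_ge0.
Qed.

Lemma coarse_partition (a b : R) : a <= b -> exists l, itv_partition a b l.
Proof.
rewrite le_eqVlt => /predU1P[->|ab]; first by exists [::]; split => /=.
by exists [:: b]; exact: itv_partition1.
Qed.

(** The a-th power of the a-variation is superadditive, because partitions can
be concatenated. *)
Lemma pvar_control m n a (A : R -> R -> 'M[R]_(m, n)) : 0 < a ->
  (forall s, A s s = 0) -> (pvar a A 0 T < +oo)%E ->
  exists2 w, is_control T w & forall s t i j, 0 <= s -> s <= t -> t <= T ->
    `|A s t i j| <= w s t `^ a^-1.
Proof.
move=> a0 Axx Afin; have aV0 : 0 < a^-1 by rewrite invr_gt0.
set f := fun u v => enorm (A u v) `^ a.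
have f0 u v : 0 <= f u v by exact: powR_ge0.
have [T0|T0] := ltP T 0.
  by exists (fun _ _ => 0); [exact: control0|move=> s t i j; lra].
pose E s t := [set psum f s l | l in [set l | itv_partition s t l]].
have [M MP] : exists M, forall l, itv_partition 0 T l -> psum f 0 l <= M.
  exists (fine (pvar a A 0 T) `^ a) => l lP.
  have lsup : ((psum f 0 l `^ a^-1)%:E <= pvar a A 0 T)%E.
    by apply: ereal_sup_ubound; exists l.
  have fin : pvar a A 0 T \is a fin_num.
    by rewrite fin_numElt Afin andbT (lt_le_trans _ lsup)// ltNyr.
  rewrite -[leLHS](powR_root (psum_ge0 _ _ f0) (lt0r_neq0 a0)).
  move: lsup; rewrite -(fineK fin) lee_fin => lsup.
  rewrite ge0_ler_powR ?nnegrE ?(ltW a0) ?powR_ge0//.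
  exact: le_trans (powR_ge0 _ _) lsup.
have bd s t l : 0 <= s -> t <= T -> itv_partition s t l -> psum f s l <= M.
  move=> s0 tT lP; have [k kP] := coarse_partition s0.
  have [m' mP] := coarse_partition tT.
  have := MP _ (itv_partition_cat kP (itv_partition_cat lP mP)).
  rewrite !psum_cat; have -> : last 0 k = s by case: kP => _ /eqP.
  have := psum_ge0 0 k f0; have := psum_ge0 (last s l) m' f0; lra.
have Esup s t : 0 <= s -> s <= t -> t <= T -> has_sup (E s t).
  move=> s0 st tT; split.
    by have [l lP] := coarse_partition st; exists (psum f s l), l.
  by exists M => _ [l lP <-]; exact: bd lP.
exists (fun s t => sup (E s t)); last first.
  move=> s t i j s0; rewrite le_eqVlt => /predU1P[->|st] tT.
    by rewrite Axx mxE normr0 powR_ge0.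
  have fE : f s t <= sup (E s t).
    apply: (sup_upper_bound (Esup _ _ s0 (ltW st) tT)).
    by exists [:: t]; [exact: itv_partition1|rewrite psum_cons psum_nil addr0].
  have e0 : 0 <= enorm (A s t) by exact: sqrtr_ge0.
  apply: le_trans (entry_le_enorm _ _ _) _.
  rewrite -[leLHS](powRr1 e0) -(divff (lt0r_neq0 a0)) powRrM.
  apply: (ge0_ler_powR (ltW aV0) _ _ fE); rewrite nnegrE ?f0//.
  exact: le_trans (f0 s t) fE.
split=> [s t s0 st tT|s u t s0 su ut tT].
  have [l lP] := coarse_partition st.
  apply: le_trans (psum_ge0 s l f0) _.
  by apply: (sup_upper_bound (Esup _ _ s0 st tT)); exists l.
have u0 := le_trans s0 su; have uT := le_trans ut tT.
rewrite -lerBrDr; apply: ge_sup; first by case: (Esup _ _ s0 su uT).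
move=> _ [l lP <-]; rewrite lerBrDr addrC -lerBrDr.
apply: ge_sup; first by case: (Esup _ _ u0 ut tT).
move=> _ [k kP <-]; rewrite lerBrDr addrC.
apply: (sup_upper_bound (Esup _ _ s0 (le_trans su ut) tT)).
exists (l ++ k); first exact: itv_partition_cat lP kP.
by rewrite psum_cat; case: lP => _ /eqP ->.
Qed.

Lemma pvar_small m n a (A : R -> R -> 'M[R]_(m, n)) i j : 0 < a ->
  (forall s, A s s = 0) -> (pvar a A 0 T < +oo)%E ->
  vanishing T (fun s _ t => A s t i j) -> small T a^-1 (fun s _ t => A s t i j).
Proof.
move=> a0 Axx Afin Av; split=> //.
have [w wc wP] := pvar_control a0 Axx Afin.
exists w => //; exists 1 => s u t s0 su ut tT; rewrite mul1r; apply: wP => //.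
exact: le_trans ut.
Qed.

End Variation.

(** * The rough path of the (RIE) property *)

Lemma psum_mx (R : realType) m n (A : R -> R -> 'M[R]_(m, n)) a l i j :
  psum A a l i j = psum (fun u v => A u v i j) a l.
Proof.
elim: l a => [|x l IH] a; first by rewrite !psum_nil mxE.
by rewrite !psum_cons mxE IH.
Qed.

Section RoughPath.
Variables (R : realType) (d : nat) (p T : R).
Variables (S : R -> 'rV[R]_d) (Q : nat -> seq R).
Hypotheses (p2 : 2 < p) (T0 : 0 < T) (rie : RIE p T S Q).

Let p0 : 0 < p. Proof. exact: lt_trans p2. Qed.

(** For c = 0 the quotient is infinite unless x = 0. *)
Lemma eratio_le1 (x c : R) : 0 <= x -> 0 <= c -> (eratio x c <= 1%:E)%E -> x <= c.
Proof.
rewrite /eratio => x0 c0; rewrite inver; case: ifPn => [/eqP->|cn0].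
  move: x0; rewrite le_eqVlt => /predU1P[<-//|x0].
  by rewrite gt0_muley// leye_eq.
by rewrite -EFinM lee_fin ler_pdivrMr ?mul1r// lt_neqAle eq_sym cn0.
Qed.

Lemma eratio_ge0 (x c : R) : 0 <= x -> 0 <= c -> (0 <= eratio x c)%E.
Proof.
rewrite /eratio => x0 c0; rewrite inver; case: ifPn => _.
  by rewrite mule_ge0.
by rewrite -EFinM lee_fin divr_ge0.
Qed.

Let partQ n : itv_partition 0 T (Q n).
Proof. by case: rie. Qed.

Let mem_part n y : y \in 0 :: Q n -> 0 <= y <= T.
Proof.
rewrite inE => /predU1P[->|/(itv_partition_mem (partQ n))/andP[/ltW -> ->]//].
by rewrite lexx ltW.
Qed.

(** Both suprema in the definition of (RIE) are nonnegative, so that each of them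
is at most one. *)
Lemma RIE_control : exists2 c, is_control T c &
  (forall s t i, 0 <= s -> s <= t -> t <= T -> `|incr S s t 0 i| <= c s t `^ p^-1) /\
  (forall n y z i j, y \in 0 :: Q n -> z \in 0 :: Q n -> y <= z ->
    `|(incr (ito_sum S (Q n)) y z - tensor (S y) (incr S y z)) i j|
      <= c y z `^ (2 / p)).
Proof.
have pV0 : 0 < p^-1 by rewrite invr_gt0.
have [_ _ _ _ [c cc cP]] := rie; exists c => //.
have path0 : (0 <= RIE_path p T S c)%E.
  apply: le_trans (ereal_sup_ubound _); last first.
    by exists 0, 0; split; [exact: lexx|exact: lexx|exact: ltW|reflexivity].
  by rewrite eratio_ge0 ?powR_ge0// (control_ge0 cc)// ltW.
have area0 : (0 <= RIE_area p S Q c)%E.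
  have [l0 lE] : exists l0, Q 0%N = l0 /\ (0 < size l0)%N.
    exists (Q 0%N); split=> //; have := partQ 0%N.
    by case: (Q 0%N) => // /itv_partition_nil E; move: T0; rewrite -E ltxx.
  have [k1 kE] : exists k, Q 0%N = nth 0 (Q 0%N) 0 :: k.
    by case: lE => <-; case: (Q 0%N) => // y k _; exists k.
  apply: le_trans (ereal_sup_ubound _); last first.
    exists 0%N, 0%N, 1%N => tk tm; split; last by reflexivity.
    by rewrite kE.
  apply: eratio_ge0; first exact: powR_ge0.
  have /mem_part/andP[y0 yT] : nth 0 (Q 0%N) 0 \in 0 :: Q 0%N.
    by rewrite {2}kE !inE eqxx orbT.
  by apply: (control_ge0 cc).
have path1 : (RIE_path p T S c <= 1%:E)%E.
  by apply: le_trans cP; rewrite leeDl.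
have area1 : (RIE_area p S Q c <= 1%:E)%E.
  by apply: le_trans cP; rewrite leeDr.
split.
  move=> s t i s0 st tT; apply: le_trans (entry_le_enorm _ _ _) _.
  have e0 : 0 <= enorm (incr S s t) by exact: sqrtr_ge0.
  rewrite -[leLHS](powRr1 e0) -(divff (lt0r_neq0 p0)) powRrM.
  have cst := control_ge0 cc s0 st tT.
  apply: (ge0_ler_powR (ltW pV0)); rewrite ?nnegrE ?powR_ge0//.
  apply: eratio_le1; rewrite ?powR_ge0//; apply: le_trans path1.
  by apply: ereal_sup_ubound; exists s, t.
move=> n y z i j yQ zQ; rewrite le_eqVlt => /predU1P[->|yz].
  rewrite /incr !subrr /tensor mulmx0 subrr mxE normr0 powR_ge0//.
apply: le_trans (entry_le_enorm _ _ _) _; set A := (X in enorm X).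
have e0 : 0 <= enorm A by exact: sqrtr_ge0.
have -> : enorm A = (enorm A `^ (p / 2)) `^ (2 / p).
  by rewrite -powRrM mulrA divfK ?pnatr_eq0// divff ?gt_eqF// powRr1.
have /andP[y0 yT] := mem_part yQ; have /andP[z0 zT] := mem_part zQ.
have cst := control_ge0 cc y0 (ltW yz) zT.
have p20 : 0 <= 2 / p by rewrite divr_ge0// ltW.
apply: (ge0_ler_powR p20); rewrite ?nnegrE ?powR_ge0//.
apply: eratio_le1; rewrite ?powR_ge0//; apply: le_trans area1.
apply: ereal_sup_ubound; exists n, (index y (0 :: Q n)), (index z (0 :: Q n)).
move=> tk tm; have tkE : tk = y by rewrite /tk nth_index.
have tmE : tm = z by rewrite /tm nth_index.
split; last by rewrite tkE tmE.
have zi : (index z (0%R :: Q n) < (size (Q n)).+1)%N by rewrite index_mem.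
have yi : (index y (0%R :: Q n) < (size (Q n)).+1)%N by rewrite index_mem.
rewrite -[(index z _ <= _)%N]ltnS zi andbT.
have [srt _] := partQ n.
rewrite -(lt_sorted_ltn_nth 0 (s := 0 :: Q n) srt) ?inE//.
by rewrite -/tk -/tm tkE tmE.
Qed.

Definition ito_entry l i j t : R :=
  psum (fun u v => S u 0 i * (S (Num.min v t) 0 j - S (Num.min u t) 0 j)) 0 l.

Lemma ito_entryE l i j t : ito_sum S l t i j = ito_entry l i j t.
Proof.
rewrite /ito_sum psum_mx; congr psum; apply/funext => u; apply/funext => v.
by rewrite /tensor mxE big_ord1 !mxE.
Qed.

Lemma ito_uniform e : 0 < e -> \forall n \near \oo,
  forall t i j, 0 <= t -> t <= T -> `|ito_int S Q t i j - ito_entry (Q n) i j t| <= e.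
Proof.
have [_ _ _ [I IP] _] := rie.
have main r : 0 < r -> \forall n \near \oo,
    forall t i j, 0 <= t -> t <= T -> `|I t i j - ito_sum S (Q n) t i j| <= r.
  move=> r0.
  have nb : nbhs (I : {uniform` `[0, T]%classic -> 'M[R]_d})
      [set h | forall t, `[0, T]%classic t -> ball (I t) r (h t)].
    apply/uniform_nbhs; exists [set xy | ball xy.1 r xy.2]; split=> //.
    exact: (entourage_ball _ (PosNum r0)).
  have : \forall n \near \oo, forall t, `[0, T]%classic t ->
      ball (I t) r (ito_sum S (Q n) t) by exact: (IP _ nb).
  apply: filterS => n nP t i j t0 tT.
  have : ball (I t) r (ito_sum S (Q n) t) by apply: nP; rewrite /= in_itv /= t0.
  by move=> [_ /(_ i j)]; rewrite /ball /= => /ltW.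
have IE t : 0 <= t -> t <= T -> ito_int S Q t = I t.
  move=> t0 tT; apply/cvg_lim => //; apply/cvgrPdist_le => r r0.
  have := main _ r0; apply: filterS => n nP.
  rewrite /Num.Def.normr/= mx_normrE (bigmax_le _ (ltW r0))//= => -[i j] _.
  by rewrite !mxE; exact: nP.
move=> e0; have := main _ e0; apply: filterS => n nP t i j t0 tT.
by rewrite IE// -ito_entryE nP.
Qed.

Lemma areaE s t i j : area S Q s t i j =
  ito_int S Q t i j - ito_int S Q s i j - S s 0 i * (S t 0 j - S s 0 j).
Proof. by rewrite /area /incr /tensor !mxE big_ord1 !mxE. Qed.

(** Chen's relation: the indefinite integral is additive and cancels. *)
Lemma chen s u t i j : defect (fun s t => area S Q s t i j) s u t =
  (S u 0 i - S s 0 i) * (S t 0 j - S u 0 j).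
Proof. by rewrite /defect !areaE; ring. Qed.

Lemma path_vanishing i : vanishing T (fun s _ t => S t 0 i - S s 0 i).
Proof. by have [Sc _ _ _ _] := rie; exact/uniform_modulus/entry_continuous. Qed.

Lemma path_small i : small T p^-1 (fun s _ t => S t 0 i - S s 0 i).
Proof.
split; last exact: path_vanishing.
have [c cc [cS _]] := RIE_control; exists c => //; exists 1 => s u t s0 su ut tT.
by have := cS s t i s0 (le_trans su ut) tT; rewrite mul1r /incr !mxE.
Qed.

(** Finitely many steps along a sufficiently fine partition reach every time. *)
Lemma vanishing_bounded (f : R -> R) : vanishing T (fun s _ t => f t - f s) ->
  exists C, forall s, 0 <= s -> s <= T -> `|f s| <= C.
Proof.
move=> fV; have [h h0 hP] := fV 1 ltr01.
have [l lP lh] := fine_partition (ltW T0) h0.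
suff H a k : 0 <= a -> itv_partition a T k -> mesh a k < h ->
    exists C, forall s, a <= s -> s <= T -> `|f s - f a| <= C.
  have [C CP] := H 0 l (lexx 0) lP lh; exists (C + `|f 0|) => s s0 sT.
  by rewrite -[f s](subrK (f 0)) (le_trans (ler_normD _ _))// lerD// CP.
elim: k a => [|x k IH] a a0.
  move=> /itv_partition_nil -> _; exists 0 => s Ts sT.
  have -> : s = T by apply/eqP; rewrite eq_le sT.
  by rewrite subrr normr0.
move=> /itv_partition_consE[ax kP]; rewrite mesh_cons_lt => /andP[xah kh].
have xT := itv_partition_le kP; have x0 := le_trans a0 (ltW ax).
have [C CP] := IH _ x0 kP kh; exists (`|C| + 1) => s as_ sT.
have [sx|xs] := leP s x.
  have : `|f s - f a| <= 1 by apply: (hP a a s) => //; lra.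
  by move=> /le_trans; apply; rewrite lerDr.
have -> : f s - f a = (f s - f x) + (f x - f a) by ring.
rewrite (le_trans (ler_normD _ _))// lerD//.
  by rewrite (le_trans (CP _ (ltW xs) sT))// ler_norm.
by apply: (hP a a x) => //; exact: ltW.
Qed.

Lemma vanishing_min f v : 0 <= v -> v <= T -> vanishing T (fun s _ t => f t - f s) ->
  vanishing T (fun s _ t => f (Num.min v t) - f (Num.min v s)).
Proof.
move=> v0 vT fV e /fV[h h0 hP]; exists h => // s u t s0 su ut tT sth.
have st := le_trans su ut.
apply: (hP _ (Num.min v s)); rewrite ?lexx//.
- by rewrite le_min v0.
- by rewrite le_min !ge_min lexx st orbT.
- by rewrite ge_min vT.
- by rewrite /Num.min /Order.min; case: ifP; case: ifP => //; lra.
Qed.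

Lemma ito_entry_vanishing n i j :
  vanishing T (fun s _ t => ito_entry (Q n) i j t - ito_entry (Q n) i j s).
Proof.
rewrite /ito_entry; set f := fun t u v => S u 0 i * (S (Num.min v t) 0 j - S (Num.min u t) 0 j).
suff H l a : 0 <= a -> itv_partition a T l ->
  vanishing T (fun s _ t => psum (f t) a l - psum (f s) a l) by exact: (H _ _ (lexx 0)).
elim: l a => [|x l IH] a a0.
  move=> _ e e0; exists 1 => // *; by rewrite !psum_nil subrr normr0 ltW.
move=> /itv_partition_consE[ax lP]; have x0 := le_trans a0 (ltW ax).
have xT := itv_partition_le lP.
have Sj := path_vanishing j.
have V1 := vanishing_min x0 xT Sj.
have V2 := vanishing_min a0 (le_trans (ltW ax) xT) Sj.
have := vanishingD (vanishing_bdd (bounded3_cst T (S a 0 i))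
  (vanishingD V1 (vanishing_bdd (bounded3_cst T (- 1)) V2))) (IH _ x0 lP).
move=> H e /H[h h0 hP]; exists h => // s u t s0 su ut tT sth.
apply: le_trans (hP s u t s0 su ut tT sth); rewrite !psum_cons /f.
rewrite le_eqVlt; apply/orP; left; apply/eqP; congr `|_|; ring.
Qed.

Lemma ito_vanishing i j :
  vanishing T (fun s _ t => ito_int S Q t i j - ito_int S Q s i j).
Proof.
move=> e e0; have e30 : 0 < e / 3 by rewrite divr_gt0.
have [n nP] := filter_ex (ito_uniform e30).
have [h h0 hP] := ito_entry_vanishing n i j e30.
exists h => // s u t s0 su ut tT sth; have st := le_trans su ut.
have := hP _ _ _ s0 su ut tT sth.
have := nP s i j s0 (le_trans st tT); have := nP t i j (le_trans s0 st) tT.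
by rewrite !ler_norml; lra.
Qed.

Lemma area_vanishing i j : vanishing T (fun s _ t => area S Q s t i j).
Proof.
have [C CP] := vanishing_bounded (path_vanishing i).
have Sb : bounded3 T (fun s _ _ => - S s 0 i).
  by exists C => s u t s0 su ut tT; rewrite normrN CP// (le_trans su) ?(le_trans ut).
have := vanishingD (ito_vanishing i j) (vanishing_bdd Sb (path_vanishing j)).
by congr vanishing; apply/funext => s; apply/funext => u; apply/funext => t;
  rewrite areaE mulNr.
Qed.

Lemma near_partition (a b h s : R) l : 0 < h -> itv_partition a b l -> mesh a l < h ->
  a <= s -> s <= b ->
  exists y z, [/\ y \in a :: l, z \in a :: l, y <= s, s <= z & z - y < h].
Proof.
move=> h0; elim: l a => [|x l IH] a.
  move=> /itv_partition_nil <- _ as_ sa; exists a, a.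
  by rewrite !mem_head as_ sa subrr.
move=> /itv_partition_consE[ax lP]; rewrite mesh_cons_lt => /andP[xah lh] as_ sb.
have [sx|/ltW xs] := leP s x.
  by exists a, x; rewrite mem_head !inE eqxx orbT.
have [y [z [yl zl ys sz zyh]]] := IH _ lP lh xs sb.
by exists y, z; rewrite inE yl inE zl !orbT.
Qed.

Lemma mesh_near h : 0 < h -> \forall n \near \oo, mesh 0 (Q n) < h.
Proof.
have [_ _ Qm _ _] := rie; move/cvgrPdist_lt : Qm => Qm /Qm; apply: filterS => n.
by rewrite sub0r normrN; exact: le_lt_trans (ler_norm _).
Qed.

(** The bound on the area, postulated at the points of the partitions only,
extends to all intervals: approximate an interval by partition points from the
inside, where the control is not larger. *)
Lemma area_small i j : small T (2 / p) (fun s _ t => area S Q s t i j).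
Proof.
split; last exact: area_vanishing.
have [c cc [_ cA]] := RIE_control; exists c => //; exists 1 => s u t s0 su ut tT.
have {u su ut} st := le_trans su ut; rewrite mul1r.
have [->|sNt] := eqVneq s t; first by rewrite areaE !subrr mulr0 subrr normr0 powR_ge0.
have {sNt}st' : s < t by rewrite lt_neqAle sNt.
have [M MP] := vanishing_bounded (path_vanishing i).
have [N NP] := vanishing_bounded (path_vanishing j).
have sT := le_trans st tT; have t0 := le_trans s0 st.
have MN0 : 0 <= M + N by rewrite addr_ge0//; [apply: le_trans (MP s _ _)|apply: le_trans (NP s _ _)].
apply/ler_addgt0Pr => e e0; set k := 4 + 2 * (M + N).
have k0 : 0 < k by rewrite /k; lra.
set r := e / k; have r0 : 0 < r by rewrite divr_gt0.
have [h1 h10 A1] := area_vanishing i j r0.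
have [h2 h20 Si] := path_vanishing i r0; have [h3 h30 Sj] := path_vanishing j r0.
set h := Num.min (Num.min h1 h2) (Num.min h3 ((t - s) / 2)).
have h0 : 0 < h by rewrite !lt_min h10 h20 h30 divr_gt0// subr_gt0.
have hle : [/\ h <= h1, h <= h2, h <= h3 & h <= (t - s) / 2].
  by rewrite !ge_min !lexx !orbT.
have {hle}[hh1 hh2 hh3 hts] := hle.
have [n [nI nh]] := filter_ex (filterI (ito_uniform r0) (mesh_near h0)).
have [y' [y [_ yQ y's sy yh]]] := near_partition h0 (partQ n) nh s0 sT.
have [z [z' [zQ _ zt tz' zh]]] := near_partition h0 (partQ n) nh t0 tT.
have yz : y <= z by lra.
have {y' z' y's tz' yh zh}[yh zh] : y - s < h /\ t - z < h by split; lra.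
have y0 := le_trans s0 sy; have zT := le_trans zt tT; have z0 := le_trans y0 yz.
have yT := le_trans yz zT.
have area_yz : `|area S Q y z i j| <= c s t `^ (2 / p) + 2 * r.
  have -> : area S Q y z i j = (incr (ito_sum S (Q n)) y z
      - tensor (S y) (incr S y z)) i j
      + ((ito_int S Q z i j - ito_entry (Q n) i j z)
         - (ito_int S Q y i j - ito_entry (Q n) i j y)).
    by rewrite areaE -!ito_entryE /incr /tensor !mxE big_ord1 !mxE; ring.
  rewrite (le_trans (ler_normD _ _))// lerD//; last first.
    by rewrite (le_trans (ler_normB _ _))// mulr_natl mulr2n lerD// nI.
  apply: le_trans (cA _ _ _ _ _ yQ zQ yz) _.
  have p20 : 0 <= 2 / p by rewrite divr_ge0// ltW.
  apply: (ge0_ler_powR p20); rewrite ?nnegrE.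
  - exact: (control_ge0 cc).
  - exact: (control_ge0 cc).
  - exact: (control_le cc).
have -> : area S Q s t i j = area S Q y z i j + (area S Q s y i j + area S Q z t i j)
    + ((S y 0 i - S s 0 i) * (S t 0 j - S y 0 j)
       + (S z 0 i - S y 0 i) * (S t 0 j - S z 0 j)).
  by rewrite -!chen /defect; ring.
have a1 : `|area S Q s y i j| <= r by apply: (A1 s s) => //; lra.
have a2 : `|area S Q z t i j| <= r by apply: (A1 z z) => //; lra.
have s1 : `|(S y 0 i - S s 0 i) * (S t 0 j - S y 0 j)| <= r * (2 * N).
  rewrite normrM ler_pM//; first by apply: (Si s s) => //; lra.
  by rewrite (le_trans (ler_normB _ _))// mulr_natl mulr2n lerD// NP.
have s2 : `|(S z 0 i - S y 0 i) * (S t 0 j - S z 0 j)| <= (2 * M) * r.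
  rewrite normrM ler_pM//; last by apply: (Sj z z) => //; lra.
  by rewrite (le_trans (ler_normB _ _))// mulr_natl mulr2n lerD// MP.
have -> : c s t `^ (2 / p) + e = c s t `^ (2 / p) + 2 * r + (r + r)
    + (r * (2 * N) + (2 * M) * r).
  by rewrite /r /k; field; rewrite gt_eqF.
by do 3 rewrite (le_trans (ler_normD _ _))// ?lerD//.
Qed.

Lemma ito_entry_step l1 x l2 i j t : path <%R 0 (l1 ++ x :: l2) ->
  last 0 l1 <= t -> t <= x ->
  ito_entry (l1 ++ x :: l2) i j t =
  psum (fun u v => S u 0 i * (S v 0 j - S u 0 j)) 0 l1
  + S (last 0 l1) 0 i * (S t 0 j - S (last 0 l1) 0 j).
Proof.
rewrite /ito_entry; set f := fun u v => _ * (S (Num.min v t) 0 j - _).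
set g := fun u v => _ * (S v 0 j - _).
have tail a l : t <= a -> path <%R a l -> psum f a l = 0.
  elim: l a => [|y l IH] a ta; first by rewrite psum_nil.
  move=> /= /andP[ay yl]; rewrite psum_cons IH ?(le_trans ta (ltW ay))//.
  by rewrite /f !min_r ?(le_trans ta (ltW ay))// subrr mulr0 addr0.
suff H a : path <%R a (l1 ++ x :: l2) -> last a l1 <= t -> t <= x ->
  psum f a (l1 ++ x :: l2) = psum g a l1 +
    S (last a l1) 0 i * (S t 0 j - S (last a l1) 0 j) by exact: H.
elim: l1 a => [|y l1 IH] a.
  rewrite /= => /andP[ax xl2] at_ tx; rewrite psum_cons psum_nil tail//.
  by rewrite /f min_r// min_l// add0r addr0.
rewrite cat_cons /= => /andP[ay yp] lt tx.
rewrite !psum_cons IH// -addrA; congr (_ + _).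
have yt : y <= t.
  apply: le_trans lt; apply: (@itv_partition_le _ _ _ _ l1); split=> //.
  by move: yp; rewrite cat_path => /andP[].
by rewrite /f /g !min_l// (le_trans (ltW ay)).
Qed.

Definition ito_error n i j t : R := ito_int S Q t i j - ito_entry (Q n) i j t.

(** At consecutive points of the n-th partition, the approximation has no area
at all. *)
Lemma area_ito_error n l1 x l2 i j : Q n = l1 ++ x :: l2 ->
  area S Q (last 0 l1) x i j
    = ito_error n i j x - ito_error n i j (last 0 l1).
Proof.
move=> QE; have [Qp _] := partQ n; rewrite QE in Qp.
have ux : last 0 l1 <= x.
  by move: Qp; rewrite cat_path /= => /and3P[_ /ltW].
rewrite areaE /ito_error QE !ito_entry_step//; ring.
Qed.

Lemma psum_area_ito_error (D : R -> R) n l1 l2 i j : Q n = l1 ++ l2 ->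
  psum (fun s v => D s * area S Q s v i j) 0 l1 =
  psum (fun s v => D s * (ito_error n i j v - ito_error n i j s)) 0 l1.
Proof.
elim/last_ind: l1 l2 => [|l1 x IH] l2; first by rewrite !psum_nil.
by rewrite cat_rcons => QE; rewrite !psum_rcons (IH _ QE) (area_ito_error _ _ QE).
Qed.

End RoughPath.

(** * The area along the defining partitions *)

Section AreaSums.
Variables (R : realType) (d : nat) (p T : R).
Variables (S : R -> 'rV[R]_d) (Q : nat -> seq R).
Hypotheses (p2 : 2 < p) (T0 : 0 < T) (rie : RIE p T S Q).

(** At the points of the n-th partition, (RIE) bounds the approximate area by the
same power of a control as the area, uniformly in n; their difference is the
increment of the error. *)
Lemma ito_error_increment i j : exists2 v, is_control T v & exists2 C, 0 <= C &
  forall n y z, y \in 0 :: Q n -> z \in 0 :: Q n -> y <= z ->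
  `|ito_error S Q n i j z - ito_error S Q n i j y| <= C * v y z `^ (2 / p).
Proof.
have p0 : 0 < p by exact: lt_trans p2. have p20 : 0 <= 2 / p by rewrite divr_ge0// ltW.
have [c cc [_ cA]] := RIE_control p2 T0 rie.
have [[c1 c1c [C1 c1A]] _] := area_small p2 T0 rie i j.
exists (fun s t => c1 s t + c s t); first exact: control_add.
exists (`|C1| + 1); first by rewrite addr_ge0.
move=> n y z yQ zQ yz.
have partQ : itv_partition 0 T (Q n) by case: rie.
have mem_part x : x \in 0 :: Q n -> 0 <= x <= T.
  rewrite inE => /predU1P[->|/(itv_partition_mem partQ)/andP[/ltW -> ->]//].
  by rewrite lexx ltW.
have /andP[y0 yT] := mem_part _ yQ; have /andP[z0 zT] := mem_part _ zQ.
have c1yz := control_ge0 c1c y0 yz zT; have cyz := control_ge0 cc y0 yz zT.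
have -> : ito_error S Q n i j z - ito_error S Q n i j y = area S Q y z i j
    - (incr (ito_sum S (Q n)) y z - tensor (S y) (incr S y z)) i j.
  rewrite /ito_error -!ito_entryE areaE /incr /tensor !mxE big_ord1 !mxE; ring.
rewrite (le_trans (ler_normB _ _))// mulrDl mul1r lerD//.
  apply: le_trans (c1A y y z y0 (lexx y) yz zT) _.
  rewrite (@le_trans _ _ (`|C1| * c1 y z `^ (2 / p)))//.
    by rewrite ler_wpM2r ?powR_ge0// ler_norm.
  rewrite ler_wpM2l//; apply: (ge0_ler_powR p20); rewrite ?nnegrE ?addr_ge0//.
  by rewrite lerDl.
apply: le_trans (cA _ _ _ _ _ yQ zQ yz) _.
by apply: (ge0_ler_powR p20); rewrite ?nnegrE ?addr_ge0// lerDr.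
Qed.

(** Between consecutive partition points the area is the increment of the error of the
approximating integrals.  This error tends to zero uniformly while its
2/p-regularity persists, so that Young's maximal inequality applies to an
interpolation of the two. *)
Lemma psum_area_null b (D : R -> R) i j : 0 < b -> b < 1 -> 1 < b + 2 / p ->
  small T b (fun s _ t => D t - D s) ->
  forall e, 0 < e -> \forall n \near \oo, forall l1 l2, Q n = l1 ++ l2 ->
  `|psum (fun s v => D s * area S Q s v i j) 0 l1| <= e.
Proof.
move=> b0 b1 bp Dsmall e e0.
have p0 : 0 < p by exact: lt_trans p2.
(* The exponent b' is less than 2 / p, which leaves room for the interpolation,
but b + b' still exceeds one. *)
set a := 2 / p in bp *; have a1 : a < 1 by rewrite /a ltr_pdivrMr// mul1r.
set b' := (1 - b + a) / 2.
have b'0 : 0 < b' by rewrite /b'; lra.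
have b'a : b' < a by rewrite /b'; lra.
have th1 : 1 < b + b' by rewrite /b'; lra.
have th0 : 0 <= b + b' by lra.
have a0 : 0 < a by exact: lt_trans b'a.
have [K K0 KP] := young_maximal T th1.
have [[w wc [C wD]] DV] := Dsmall.
have [M MP] := vanishing_bounded T0 DV.
have [v vc [C1 C10 vE]] := ito_error_increment i j.
have wvc := control_add wc vc.
set c := fun s t => w s t + v s t in wvc.
set l := 1 - b' / a.
have l0 : 0 < l by rewrite /l subr_gt0 ltr_pdivrMr// mul1r.
set C2 := C1 `^ (b' / a).
set A := K * (`|C| * C2) * c 0 T `^ (b + b').
have c0T : 0 <= c 0 T by apply: (control_ge0 wvc) => //; exact: ltW.
have A0 : 0 <= A by rewrite !mulr_ge0 ?powR_ge0.
have M0 : 0 <= M by apply: le_trans (MP 0 _ _) => //; exact: ltW.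
set r := Num.min ((e / 2 / (A + 1)) `^ l^-1 / 2) (e / 2 / (2 * (M + 1))).
have e20 : 0 < e / 2 by rewrite divr_gt0.
have A10 : 0 < A + 1 by rewrite ltr_wpDl.
have M10 : 0 < M + 1 by rewrite ltr_wpDl.
have eA0 : 0 < e / 2 / (A + 1) by rewrite divr_gt0.
have r0 : 0 < r.
  rewrite lt_min; apply/andP; split; apply: divr_gt0 => //.
    exact: powR_gt0.
  by rewrite mulr_gt0.
set rho := (2 * r) `^ l.
have rho0 : 0 <= rho by exact: powR_ge0.
have rhoA : A * rho <= e / 2.
  have : rho <= e / 2 / (A + 1).
    have e2A : 0 <= e / 2 / (A + 1) by rewrite divr_ge0// ltW.
    rewrite -[leRHS](powR_root e2A (lt0r_neq0 l0)).
    apply: (ge0_ler_powR (ltW l0)); rewrite ?nnegrE ?powR_ge0 ?mulr_ge0 ?(ltW r0)//.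
    by rewrite mulrC -ler_pdivlMr// ge_min lexx.
  move=> /(ler_wpM2l A0)/le_trans; apply.
  by rewrite mulrA ler_pdivrMr// mulrC ler_wpM2l ?(ltW e20)// lerDl.
have rM : M * (2 * r) <= e / 2.
  have : r <= e / 2 / (2 * (M + 1)) by rewrite ge_min lexx orbT.
  rewrite ler_pdivlMr ?mulr_gt0//; apply: le_trans.
  by move: (ltW r0); lra.
have := ito_uniform rie r0; apply: filterS => n nE l1 l2 QE.
have [Qp /eqP QT] : itv_partition 0 T (Q n) by case: rie.
have mem_part x : x \in 0 :: l1 -> 0 <= x <= T /\ x \in 0 :: Q n.
  move=> x1; have xQ : x \in 0 :: Q n by rewrite QE -cat_cons mem_cat x1.
  split=> //; move: xQ; rewrite inE => /predU1P[->|].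
    by rewrite lexx ltW.
  by have partQ : itv_partition 0 T (Q n) by [case: rie];
    move=> /(itv_partition_mem partQ)/andP[/ltW -> ->].
rewrite (psum_area_ito_error rie _ _ _ QE).
set E := ito_error S Q n i j.
have Er x y : 0 <= x -> x <= T -> 0 <= y -> y <= T -> `|E x - E y| <= 2 * r.
  move=> x0 xT y0 yT; rewrite (le_trans (ler_normB _ _))// mulr_natl mulr2n.
  by rewrite lerD// nE.
set Xi := fun s t => D s * (E t - E s).
have lastm : last 0 l1 \in 0 :: l1 by exact: mem_last.
have [/andP[u0 uT] uQ] := mem_part _ lastm.
have XiD : `|Xi 0 (last 0 l1)| <= M * (2 * r).
  by rewrite /Xi normrM ler_pM// ?MP ?Er// ltW.
have p1 : path <%R 0 l1 by move: Qp; rewrite QE cat_path => /andP[].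
have main : `|psum Xi 0 l1 - Xi 0 (last 0 l1)| <= A * rho.
  have C20 : 0 <= `|C| * C2 * rho by rewrite !mulr_ge0 ?powR_ge0.
  apply: le_trans (KP _ Xi _ _ _ wvc C20 (lexx 0) uT p1 _) _; last first.
    rewrite /A -!mulrA ler_wpM2l// ler_wpM2l// ler_wpM2l ?powR_ge0// mulrC.
    rewrite ler_wpM2r//; apply: (ge0_ler_powR th0); rewrite ?nnegrE//.
      exact: (control_ge0 wvc).
    exact: (control_le wvc).
  move=> s u t sm um tm su ut.
  have [/andP[s0 sT] sQ] := mem_part _ sm; have [/andP[u0' uT'] uQ'] := mem_part _ um.
  have [/andP[t0 tT] tQ] := mem_part _ tm.
  have -> : defect Xi s u t = - ((D u - D s) * (E t - E u)).
    by rewrite /defect /Xi; ring.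
  have Dsu : `|D u - D s| <= `|C| * c s t `^ b.
    apply: le_trans (wD s s u s0 (lexx s) su uT') _.
    rewrite (@le_trans _ _ (`|C| * w s u `^ b))//.
      by rewrite ler_wpM2r ?powR_ge0// ler_norm.
    rewrite ler_wpM2l//; apply: (ge0_ler_powR (ltW b0)); rewrite ?nnegrE.
    - exact: (control_ge0 wc).
    - by apply: (control_ge0 wvc) => //; exact: le_trans ut.
    - rewrite (@le_trans _ _ (w s t))//; first exact: (control_le wc).
      by rewrite lerDl (control_ge0 vc)// (le_trans su).
  have Eut : `|E t - E u| <= rho * (C2 * c s t `^ b').
    have vut := control_ge0 vc u0' ut tT.
    apply: le_trans (powR_interpolation b'0 b'a C10 (normr_ge0 _) vut
      (Er _ _ t0 tT u0' uT') (vE _ _ _ uQ' tQ ut)) _.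
    rewrite ler_wpM2l// ler_wpM2l ?powR_ge0//.
    apply: (ge0_ler_powR (ltW b'0)); rewrite ?nnegrE//.
    - by apply: (control_ge0 wvc) => //; exact: le_trans ut.
    - rewrite (@le_trans _ _ (v s t))//; first exact: (control_le vc).
      by rewrite lerDr (control_ge0 wc)// (le_trans su).
  rewrite normrN normrM (le_trans (ler_pM _ _ Dsu Eut))//.
  rewrite powRD; last by rewrite gt_eqF// ltr_pwDr// ltW.
  by rewrite le_eqVlt; apply/orP; left; apply/eqP; ring.
rewrite -(subrK (Xi 0 (last 0 l1)) (psum Xi 0 l1)) (le_trans (ler_normD _ _))//.
by rewrite [leRHS]splitr lerD// (le_trans main _, le_trans XiD _).
Qed.

(** In general t is not one of the points of Q n; the one interval that ends at t
is harmless because the area vanishes uniformly on short intervals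
[area_sum_cvg0]. *)
Definition cut_part n t : seq R := rcons [seq x <- Q n | x < t] t.

Lemma sorted_cut (l : seq R) t : sorted <%R l ->
  l = [seq x <- l | x < t] ++ [seq x <- l | t <= x].
Proof.
elim: l => // x l IH /= xl; have := IH (path_sorted xl).
have [xt|tx] := ltP x t; first by rewrite cat_cons => {1}->.
move=> _; rewrite (_ : [seq y <- l | y < t] = [::]) /=; last first.
  apply/eqP; rewrite -[_ == _]negbK -has_filter; apply/hasPn => y yl.
  rewrite -leNgt (le_trans tx)// ltW//.
  by move: xl; rewrite lt_path_sortedE => /andP[/allP/(_ _ yl)].
congr cons; apply/esym/all_filterP/allP => y yl.
rewrite (le_trans tx)// ltW//.
by move: xl; rewrite lt_path_sortedE => /andP[/allP/(_ _ yl)].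
Qed.

Lemma cut_partition n t : 0 < t -> itv_partition 0 t (cut_part n t).
Proof.
move=> t0; have [Qp _] : itv_partition 0 T (Q n) by case: rie.
split; last by rewrite /cut_part last_rcons.
rewrite /cut_part rcons_path path_filter//=; last exact: lt_trans.
have := mem_last 0 [seq x <- Q n | x < t].
by rewrite inE => /predU1P[->//|]; rewrite mem_filter => /andP[].
Qed.

Lemma cut_split n t : 0 < t -> t <= T -> exists y l,
  Q n = [seq x <- Q n | x < t] ++ y :: l /\ t <= y.
Proof.
move=> t0 tT; have partQ : itv_partition 0 T (Q n) by case: rie.
have srt : sorted <%R (Q n) by case: partQ => /path_sorted.
have TQ : T \in [seq x <- Q n | t <= x].
  rewrite mem_filter tT /=; have [_ /eqP lastT] := partQ.
  have := mem_last 0 (Q n); rewrite lastT inE => /predU1P[E|//].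
  by move: T0; rewrite E ltxx.
case E : [seq x <- Q n | t <= x] TQ => [//|y l] _.
exists y, l; rewrite -E -sorted_cut//; split=> //.
have : y \in [seq x <- Q n | t <= x] by rewrite E mem_head.
by rewrite mem_filter => /andP[].
Qed.

Lemma mesh_cut n t h : 0 < h -> 0 < t -> t <= T -> mesh 0 (Q n) < h ->
  mesh 0 (cut_part n t) < h.
Proof.
move=> h0 t0 tT; have [y [l [QE ty]]] := cut_split n t0 tT.
rewrite {1}QE mesh_cat_lt// mesh_cons_lt => /and3P[m1 m2 _].
rewrite /cut_part -cats1 mesh_cat_lt// m1 mesh_cons_lt mesh_nil_lt h0 andbT /=.
by rewrite (le_lt_trans _ m2)// lerB.
Qed.

Lemma cut_part_cvg t : 0 < t -> t <= T -> cut_part n t @[n --> \oo] --> mesh_to0 0 t.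
Proof.
move=> t0 tT A [h /= h0 hA]; have := mesh_near rie h0; apply: filterS => n nh.
by apply: hA; split; [exact: cut_partition|exact: mesh_cut].
Qed.

Lemma area_sum_cvg0 b (D : R -> R) i j t : 0 < b -> b < 1 -> 1 < b + 2 / p ->
  small T b (fun s _ t => D t - D s) -> 0 < t -> t <= T ->
  psum (fun s v => D s * area S Q s v i j) 0 (cut_part n t) @[n --> \oo] --> 0.
Proof.
move=> b0 b1 bp Ds t0 tT; apply/cvgrPdist_le => e e0.
have e20 : 0 < e / 2 by rewrite divr_gt0.
have [M MP] := vanishing_bounded T0 Ds.2.
have M0 : 0 <= M by apply: le_trans (MP 0 _ _) => //; exact: ltW.
have M10 : 0 < M + 1 by rewrite ltr_wpDl.
have [h h0 hA] := area_vanishing T0 rie i j (divr_gt0 e20 M10).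
move: (psum_area_null i j b0 b1 bp Ds e20) (mesh_near rie h0).
apply: filterS2 => n nA nh; rewrite sub0r normrN.
have [y [l [QE ty]]] := cut_split n t0 tT.
rewrite /cut_part psum_rcons [e]splitr (le_trans (ler_normD _ _))// lerD//.
  exact: nA QE.
have := mesh_cut h0 t0 tT nh; have := cut_partition n t0.
rewrite /cut_part -cats1 => /itv_partition_catE[uP /itv_partition_consE[ut _]].
rewrite mesh_cat_lt// mesh_cons_lt => /and3P[_ uth _].
have u0 := itv_partition_le uP.
rewrite normrM -[leRHS](divfK (lt0r_neq0 M10)) mulrC ler_pM//.
  by apply: (hA _ (last 0 [seq x <- Q n | x < t])) => //; exact: ltW.
rewrite (le_trans (MP _ u0 _)) ?lerDl//.
by rewrite (le_trans (ltW ut)).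
Qed.

End AreaSums.

(** * Controlled paths, one component at a time *)

Section SmallPaths.
Variables (R : realType) (T : R).
Hypothesis T0 : 0 < T.
Implicit Types f g : R -> R.

Definition small_path (a : R) f := small T a (fun s _ t => f t - f s).

Lemma small_path_bounded a f : small_path a f ->
  exists C, forall s, 0 <= s -> s <= T -> `|f s| <= C.
Proof. by case=> _; exact: vanishing_bounded. Qed.

Lemma bounded_start f : (exists C, forall s, 0 <= s -> s <= T -> `|f s| <= C) ->
  bounded3 T (fun s _ _ => f s).
Proof.
move=> [C CP]; exists C => s u t s0 su ut tT.
by apply: CP => //; rewrite (le_trans su)// (le_trans ut).
Qed.

Lemma bounded_end f : (exists C, forall s, 0 <= s -> s <= T -> `|f s| <= C) ->
  bounded3 T (fun _ _ t => f t).
Proof.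
move=> [C CP]; exists C => s u t s0 su ut tT.
by apply: CP => //; rewrite (le_trans s0)// (le_trans su).
Qed.

Lemma small_path_cst a c : small_path a (fun _ => c).
Proof. by apply: (eq_small _ (small0 T a)) => *; rewrite subrr. Qed.

Lemma small_pathM a f g : 0 <= a -> small_path a f -> small_path a g ->
  small_path a (fun s => f s * g s).
Proof.
move=> a0 fs gs.
have fb := bounded_end (small_path_bounded fs).
have gb := bounded_start (small_path_bounded gs).
apply: (eq_small _ (smallD a0 (small_bdd fb gs) (small_bdd gb fs))) => *; ring.
Qed.

Lemma small_path_sum a (I : finType) (f : I -> R -> R) : 0 <= a ->
  (forall i, small_path a (f i)) -> small_path a (fun s => \sum_i f i s).
Proof.
by move=> a0 fs; apply: (eq_small _ (small_sum a0 fs)) => *; rewrite -sumrB.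
Qed.

Lemma small_path_le a b f : 0 < a -> a <= b -> small_path b f -> small_path a f.
Proof. exact: small_le. Qed.

Lemma inv_bounded f m : 0 < m -> (forall s, 0 <= s -> s <= T -> m <= f s) ->
  exists C, forall s, 0 <= s -> s <= T -> `|(f s)^-1| <= C.
Proof.
move=> m0 mf; exists m^-1 => s s0 sT; have ms := mf _ s0 sT.
by rewrite ger0_norm ?invr_ge0 ?(le_trans (ltW m0))// lef_pV2 ?posrE// (lt_le_trans m0).
Qed.

Lemma small_path_inv a f m : 0 < m -> (forall s, 0 <= s -> s <= T -> m <= f s) ->
  small_path a f -> small_path a (fun s => (f s)^-1).
Proof.
move=> m0 mf fs; have fV := inv_bounded m0 mf.
have b := bounded3M (bounded3M (bounded3_cst T (- 1)) (bounded_start fV)) (bounded_end fV).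
apply: (eq_small _ (small_bdd b fs)) => s u t s0 su ut tT.
have fn0 x : 0 <= x -> x <= T -> f x != 0.
  by move=> x0 xT; rewrite gt_eqF// (lt_le_trans m0)// mf.
have h1 := fn0 s s0 (le_trans (le_trans su ut) tT).
have h2 := fn0 t (le_trans s0 (le_trans su ut)) tT.
by field; rewrite h1 h2.
Qed.

End SmallPaths.

Section ControlledComponents.
Variables (R : realType) (d : nat) (T a b : R) (X : 'I_d -> R -> R).
Hypotheses (T0 : 0 < T) (a0 : 0 < a) (b0 : 0 < b) (ba : b <= a).
Hypothesis Xs : forall i, small_path T a (X i).
(** A real path f that is controlled by X: the orders a and b stand for 1/p
and 1/q. *)
Definition ctrl (f : R -> R) (f' : 'I_d -> R -> R) :=
  (forall j, small_path T b (f' j)) /\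
  small T (a + b) (fun s _ t => f t - f s - \sum_j f' j s * (X j t - X j s)).

Let a0' := ltW a0. Let b0' := ltW b0.
Let ab0 : 0 <= a + b. Proof. by rewrite addr_ge0. Qed.

Lemma ctrl_small f f' : ctrl f f' -> small_path T a f.
Proof.
move=> [f's fR].
have h1 : small T a (fun s _ t => f t - f s - \sum_j f' j s * (X j t - X j s)).
  by apply: (small_le a0 _ fR); rewrite lerDl.
have h2 : small T a (fun s _ t => \sum_j f' j s * (X j t - X j s)).
  apply: (small_sum a0' (A := fun j s u t => f' j s * (X j t - X j s))) => j.
  exact: small_bdd (bounded_start (small_path_bounded T0 (f's j))) (Xs j).
by apply: (eq_small _ (smallD a0' h1 h2)) => *; ring.
Qed.

Lemma ctrl_small_low f f' : ctrl f f' -> small_path T b f.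
Proof. by move=> /ctrl_small; exact: small_path_le. Qed.

Lemma ctrl_bounded f f' : ctrl f f' -> exists C, forall s, 0 <= s -> s <= T -> `|f s| <= C.
Proof. by move=> /ctrl_small/(small_path_bounded T0). Qed.

Lemma ctrl_der_bounded f f' j : ctrl f f' ->
  exists C, forall s, 0 <= s -> s <= T -> `|f' j s| <= C.
Proof. by move=> [/(_ j) + _]; exact: small_path_bounded. Qed.

Lemma eq_ctrl f f' g g' :
  (forall s, 0 <= s -> s <= T -> f s = g s) ->
  (forall j s, 0 <= s -> s <= T -> f' j s = g' j s) -> ctrl f f' -> ctrl g g'.
Proof.
move=> fg fg' [f's fR]; split=> [j|].
  apply: (eq_small _ (f's j)) => s u t s0 su ut tT.
  by rewrite !fg'// ?(le_trans s0)// ?(le_trans su)// (le_trans ut).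
apply: (eq_small _ fR) => s u t s0 su ut tT.
have sT := le_trans su (le_trans ut tT).
rewrite !fg// ?(le_trans s0)// ?(le_trans su)//; congr (_ - _).
by apply: eq_bigr => j _; rewrite fg'.
Qed.

Lemma ctrl_coord i : ctrl (X i) (fun j _ => (i == j)%:R).
Proof.
split=> [j|]; first exact: small_path_cst.
apply: (eq_small _ (small0 T _)) => s u t _ _ _ _.
rewrite (bigD1 i)//= eqxx mul1r big1 ?addr0 ?subrr// => j ji.
by rewrite eq_sym (negPf ji) mul0r.
Qed.

Lemma ctrl_sum (I : finType) (f : I -> R -> R) (f' : I -> 'I_d -> R -> R) :
  (forall i, ctrl (f i) (f' i)) ->
  ctrl (fun s => \sum_i f i s) (fun j s => \sum_i f' i j s).
Proof.
move=> fc; split=> [j|].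
  by apply: small_path_sum => // i; case: (fc i).
have := small_sum ab0 (fun i => (fc i).2).
apply: eq_small => s u t _ _ _ _; rewrite sumrB; congr (_ - _).
  by rewrite sumrB.
by rewrite exchange_big; apply: eq_bigr => j _; rewrite mulr_suml.
Qed.

(** The product of the increments of f and g is of order 2/p, hence at least of
order 1/p + 1/q. *)
Lemma ctrlM f f' g g' : ctrl f f' -> ctrl g g' ->
  ctrl (fun s => f s * g s) (fun j s => f' j s * g s + f s * g' j s).
Proof.
move=> fc gc; split=> [j|].
  have h1 := small_pathM T0 b0' (fc.1 j) (ctrl_small_low gc).
  have h2 := small_pathM T0 b0' (ctrl_small_low fc) (gc.1 j).
  by apply: (eq_small _ (smallD b0' h1 h2)) => *; ring.
have h1 := small_bdd (bounded_start (ctrl_bounded gc)) fc.2.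
have h2 := small_bdd (bounded_start (ctrl_bounded fc)) gc.2.
have h3 := smallM a0 a0 (ctrl_small fc) (ctrl_small gc).
have {}h3 := small_le (_ : 0 < a + b) (_ : a + b <= a + a) h3.
have {}h3 := h3 (addr_gt0 a0 b0) (lerD (lexx a) ba).
apply: (eq_small _ (smallD ab0 (smallD ab0 h1 h2) h3)) => s u t _ _ _ _.
have -> : \sum_j (f' j s * g s + f s * g' j s) * (X j t - X j s)
    = g s * \sum_j f' j s * (X j t - X j s) + f s * \sum_j g' j s * (X j t - X j s).
  by rewrite !mulr_sumr -big_split; apply: eq_bigr => j _ /=; ring.
ring.
Qed.

(** Expanding to the next order, the remainder of the inverse is the remainder of
f, divided by - f(s)^2, plus a term that is quadratic in the increment of f. *)
Lemma ctrlV f f' m : 0 < m -> (forall s, 0 <= s -> s <= T -> m <= f s) ->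
  ctrl f f' -> ctrl (fun s => (f s)^-1) (fun j s => - (f' j s * ((f s)^-1 * (f s)^-1))).
Proof.
move=> m0 mf fc.
have fV := inv_bounded m0 mf.
have Vs : small_path T b (fun s => (f s)^-1).
  by apply: (small_path_inv m0 mf); exact: ctrl_small_low fc.
split=> [j|].
  have h := small_pathM T0 b0' (fc.1 j) (small_pathM T0 b0' Vs Vs).
  by apply: (eq_small _ (smallN h)) => *; ring.
have V1 := bounded_start fV; have V2 := bounded_end fV.
have h1 := smallN (small_bdd (bounded3M V1 V1) fc.2).
have h2 := smallM a0 a0 (ctrl_small fc) (ctrl_small fc).
have {}h2 := small_le (addr_gt0 a0 b0) (lerD (lexx a) ba) h2.
have {}h2 := small_bdd (bounded3M (bounded3M V1 V1) V2) h2.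
apply: (eq_small _ (smallD ab0 h1 h2)) => s u t s0 su ut tT.
have fn0 x : 0 <= x -> x <= T -> f x != 0.
  by move=> x0 xT; rewrite gt_eqF// (lt_le_trans m0)// mf.
have e1 := fn0 s s0 (le_trans (le_trans su ut) tT).
have e2 := fn0 t (le_trans s0 (le_trans su ut)) tT.
have -> : \sum_j - (f' j s * ((f s)^-1 * (f s)^-1)) * (X j t - X j s)
    = - ((f s)^-1 * (f s)^-1 * \sum_j f' j s * (X j t - X j s)).
  by rewrite mulr_sumr -sumrN; apply: eq_bigr => j _ /=; ring.
by field; rewrite e1 e2.
Qed.

Section Germ.
Variable A : R -> R -> 'M[R]_d.
Hypothesis As : forall j k, small T (a + a) (fun s _ t => A s t j k).
Hypothesis Achen : forall s u t j k, A s t j k - A s u j k - A u t j k =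
  (X j u - X j s) * (X k t - X k u).

Definition ctrl_germ (f : R -> R) (f' : 'I_d -> R -> R) (g : R -> R)
  (g' : 'I_d -> R -> R) (s t : R) : R :=
  f s * (g t - g s) + \sum_j \sum_k f' j s * g' k s * A s t j k.

(** The leading terms of the products of increments of f and g cancel against
Chen's relation; in each remaining product the orders add up to 2/p + 1/q. *)
Lemma ctrl_germ_defect f f' g g' : ctrl f f' -> ctrl g g' ->
  small T (b + (a + a)) (defect (ctrl_germ f f' g g')).
Proof.
move=> fc gc.
have aa0 : 0 < a + a by rewrite addr_gt0.
have baa0 : 0 <= b + (a + a) by rewrite !addr_ge0.
have gs := small_right a0' (ctrl_small gc).
have Xl i := small_left a0' (Xs i); have Xr i := small_right a0' (Xs i).
have fl := small_left ab0 fc.2; have gr := small_right ab0 gc.2.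
have E1 : a + b + a = b + (a + a) by ring.
have E2 : a + (a + b) = b + (a + a) by ring.
have E3 : a + (b + a) = b + (a + a) by ring.
have t1 : small T (b + (a + a)) (fun s u t =>
    (f u - f s - \sum_j f' j s * (X j u - X j s)) * (g t - g u)).
  by rewrite -E1; exact: smallM (addr_gt0 a0 b0) a0 fl gs.
have t2 : small T (b + (a + a)) (fun s u t => \sum_j
    f' j s * ((X j u - X j s) * (g t - g u - \sum_k g' k u * (X k t - X k u)))).
  apply: small_sum => // j; apply: small_bdd (bounded_start (ctrl_der_bounded j fc)) _.
  by rewrite -E2; exact: smallM a0 (addr_gt0 a0 b0) (Xl j) gr.
have t3 : small T (b + (a + a)) (fun s u t => \sum_j \sum_k
    f' j s * ((X j u - X j s) * ((g' k u - g' k s) * (X k t - X k u)))).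
  apply: small_sum => // j; apply: small_sum => // k.
  apply: small_bdd (bounded_start (ctrl_der_bounded j fc)) _.
  rewrite -E3; apply: smallM a0 (addr_gt0 b0 a0) (Xl j) _.
  exact: smallM b0 a0 (small_left b0' (gc.1 k)) (Xr k).
have t4 : small T (b + (a + a)) (fun s u t => \sum_j \sum_k
    (f' j u * g' k u - f' j s * g' k s) * A u t j k).
  apply: small_sum => // j; apply: small_sum => // k.
  apply: smallM b0 aa0 (small_left b0' _) (small_right (ltW aa0) (As j k)).
  exact: small_pathM (fc.1 j) (gc.1 k).
have := smallN (smallD baa0 (smallD baa0 (smallD baa0 t1 t2) t3) t4).
apply: eq_small => s u t _ _ _ _; rewrite /defect /ctrl_germ.
have e2 : \sum_j f' j s * ((X j u - X j s) * (g t - g u - \sum_k g' k u * (X k t - X k u)))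
    = (\sum_j f' j s * (X j u - X j s)) * (g t - g u)
      - \sum_j \sum_k f' j s * g' k u * ((X j u - X j s) * (X k t - X k u)).
  rewrite mulr_suml -sumrB; apply: eq_bigr => j _.
  rewrite mulrA mulrBr mulr_sumr; congr (_ - _).
  by apply: eq_bigr => k _; ring.
have e3 : \sum_j \sum_k
    f' j s * ((X j u - X j s) * ((g' k u - g' k s) * (X k t - X k u)))
    = \sum_j \sum_k f' j s * g' k u * ((X j u - X j s) * (X k t - X k u))
    - \sum_j \sum_k f' j s * g' k s * ((X j u - X j s) * (X k t - X k u)).
  rewrite -sumrB; apply: eq_bigr => j _; rewrite -sumrB; apply: eq_bigr => k _; ring.
have e4 : \sum_j \sum_k (f' j u * g' k u - f' j s * g' k s) * A u t j k
    = \sum_j \sum_k f' j u * g' k u * A u t j k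
    - \sum_j \sum_k f' j s * g' k s * A u t j k.
  rewrite -sumrB; apply: eq_bigr => j _; rewrite -sumrB; apply: eq_bigr => k _; ring.
have e5 : \sum_j \sum_k f' j s * g' k s * A s t j k
    = \sum_j \sum_k f' j s * g' k s * A s u j k
    + \sum_j \sum_k f' j s * g' k s * A u t j k
    + \sum_j \sum_k f' j s * g' k s * ((X j u - X j s) * (X k t - X k u)).
  rewrite -!big_split; apply: eq_bigr => j _; rewrite -!big_split.
  by apply: eq_bigr => k _ /=; rewrite -Achen; ring.
rewrite e2 e3 e4 e5; ring.
Qed.

End Germ.

(** Young integration.  The bound on the increments of the integral shows that it
is again a possible integrator, so that Young integrals can be iterated. *)
Lemma young_integral (f g : R -> R) : small_path T b f -> small_path T (a + a) g ->
  1 < b + (a + a) ->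
  exists J : R -> R, [/\
    forall t, 0 <= t -> t <= T ->
      psum (fun s v => f s * (g v - g s)) 0 @ mesh_to0 0 t --> J t,
    small_path T (a + a) J &
    small T (b + (a + a)) (fun s _ t => J t - J s - f s * (g t - g s))].
Proof.
move=> fs gs th1.
have aa0 : 0 < a + a by rewrite addr_gt0.
have [|J [JP JR]] := @sewing R T (b + (a + a)) (fun s v => f s * (g v - g s)) th1.
  have := smallN (smallM b0 aa0 (small_left b0' fs) (small_right (ltW aa0) gs)).
  by apply: eq_small => s u t _ _ _ _; rewrite /defect; ring.
exists J; split=> //.
have h1 := small_le aa0 (_ : a + a <= b + (a + a)) JR.
have {}h1 := h1 ltac:(by rewrite lerDr).
have h2 := small_bdd (bounded_start (small_path_bounded T0 fs)) gs.
by apply: (eq_small _ (smallD (ltW aa0) h1 h2)) => *; ring.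
Qed.

End ControlledComponents.

(** * Gradients of the market map *)

Section Gradient.
Variables (R : realType) (d : nat).
Implicit Types (x y : 'rV[R]_d) (g h : 'rV[R]_d -> R).

(** The closure rules below have the same shape as those for ctrl, so that the
derivative of a smooth function at S is seen to be its Gubinelli derivative by
building the function twice from the coordinates. *)
Definition has_grad g x (g' : 'I_d -> R) :=
  differentiable g x /\ forall j, 'D_(delta_mx 0 j) g x = g' j.

Lemma has_grad_coord x i : has_grad (fun y => y 0 i) x (fun j => (i == j)%:R).
Proof.
have df := differentiable_coord x (0 : 'I_1) i.
split=> // j; rewrite deriveE//.
have @f : {linear 'rV[R]_d -> R}.
  by exists (fun N : 'rV[R]_d => N 0 i); do 2![eexists]; do ?[constructor];
     rewrite ?mxE// => ? *; rewrite ?mxE//; move=> ?; rewrite !mxE.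
rewrite (_ : (fun y => y 0 i) = f)// diff_lin.
  by rewrite /f /= mxE eqxx.
exact: coord_continuous.
Qed.

Lemma has_grad_sum x (g : 'I_d -> 'rV[R]_d -> R) (g' : 'I_d -> 'I_d -> R) :
  (forall i, has_grad (g i) x (g' i)) ->
  has_grad (fun y => \sum_i g i y) x (fun j => \sum_i g' i j).
Proof.
move=> gg; have -> : (fun y => \sum_i g i y) = \sum_i g i.
  by apply/funext => y; rewrite fct_sumE.
split=> [|j]; first by apply: differentiable_sum => i; case: (gg i).
rewrite derive_sum => [|i]; first by apply: eq_bigr => i _; case: (gg i).
by apply: diff_derivable; case: (gg i).
Qed.

Lemma has_gradM x g h (g' h' : 'I_d -> R) : has_grad g x g' -> has_grad h x h' ->
  has_grad (fun y => g y * h y) x (fun j => g' j * h x + g x * h' j).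
Proof.
move=> [dg Dg] [dh Dh]; split=> [|j]; first exact: differentiableM.
rewrite (@deriveM _ _ g h) ?Dg ?Dh; [|exact: diff_derivable..].
by rewrite addrC mulrC.
Qed.

Lemma has_gradV x g (g' : 'I_d -> R) : g x != 0 -> has_grad g x g' ->
  has_grad (fun y => (g y)^-1) x (fun j => - (g' j * ((g x)^-1 * (g x)^-1))).
Proof.
move=> gx [dg Dg]; split=> [|j]; first exact: differentiableV.
rewrite deriveV ?Dg//; last exact: diff_derivable.
by rewrite scaleNr /GRing.scale /= mulrC expr2 invfM.
Qed.

Lemma Dmx_row x (g : 'I_d -> 'rV[R]_d -> R) (g' : 'I_d -> 'I_d -> R) i j :
  (forall i, has_grad (g i) x (g' i)) ->
  Dmx (fun y => \row_i g i y) x i j = g' i j.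
Proof.
move=> gg; set f := fun y => _.
have df : differentiable f x.
  have -> : f = \sum_i (fun y => g i y *: delta_mx 0 i).
    apply/funext => y; rewrite fct_sumE /f [LHS]row_sum_delta.
    by apply: eq_bigr => k _; rewrite mxE.
  by apply: differentiable_sum => k; apply: differentiableZl; case: (gg k).
rewrite /Dmx mxE /jacobian mxE /= -deriveE// derive_mx ?mxE; last exact: diff_derivable.
rewrite -(gg i).2; congr derive.
by apply/funext => y; rewrite mxE.
Qed.

End Gradient.

Section MarketGradient.
Variables (R : realType) (d : nat).
Implicit Types x y : 'rV[R]_d.

Definition capital x : R := \sum_i x 0 i.

Lemma has_grad_capital x : has_grad (@capital) x (fun j => \sum_i (i == j)%:R).
Proof. exact: has_grad_sum (fun i => has_grad_coord x i). Qed.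

Lemma marketE x i : market x 0 i = x 0 i * (capital x)^-1.
Proof. by rewrite /market mxE mulrC. Qed.

Lemma Dmx_market x i j : capital x != 0 -> Dmx (@market R d) x i j =
  (i == j)%:R * (capital x)^-1
  + x 0 i * - ((\sum_k (k == j)%:R) * ((capital x)^-1 * (capital x)^-1)).
Proof.
move=> x0; have -> : @market R d = fun y => \row_i (y 0 i * (capital y)^-1).
  by apply/funext => y; apply/rowP => k; rewrite marketE mxE.
rewrite (Dmx_row (g' := fun i j => (i == j)%:R * (capital x)^-1
  + x 0 i * - ((\sum_k (k == j)%:R) * ((capital x)^-1 * (capital x)^-1))))// => k.
exact: has_gradM (has_grad_coord x k) (has_gradV x0 (has_grad_capital x)).
Qed.

Lemma Dmx_inv x i j : (forall i, x 0 i != 0) ->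
  Dmx (fun y => cinv y) x i j = - ((i == j)%:R * ((x 0 i)^-1 * (x 0 i)^-1)).
Proof.
move=> x0; rewrite (Dmx_row (g' := fun i j =>
  - ((i == j)%:R * ((x 0 i)^-1 * (x 0 i)^-1))))// => k.
exact: has_gradV (has_grad_coord x k).
Qed.

Lemma Dmx_inv_market x i j : (forall i, x 0 i != 0) -> capital x != 0 ->
  Dmx (fun y => cinv (market y)) x i j =
  (\sum_k (k == j)%:R) * (x 0 i)^-1
  + capital x * - ((i == j)%:R * ((x 0 i)^-1 * (x 0 i)^-1)).
Proof.
move=> x0 tx.
have -> : (fun y => cinv (@market R d y)) = fun y => \row_i (capital y * (y 0 i)^-1).
  by apply/funext => y; apply/rowP => k; rewrite !mxE invfM invrK.
rewrite (Dmx_row (g' := fun i j => (\sum_k (k == j)%:R) * (x 0 i)^-1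
  + capital x * - ((i == j)%:R * ((x 0 i)^-1 * (x 0 i)^-1))))// => k.
exact: has_gradM (has_grad_capital x) (has_gradV (x0 k) (has_grad_coord x k)).
Qed.

End MarketGradient.

(** * Integrals along the defining partitions *)

Section Integrals.
Variables (R : realType) (d : nat) (p q r T : R).
Variables (S : R -> 'rV[R]_d) (Q : nat -> seq R).
Hypotheses (p2 : 2 < p) (pq : p <= q) (pqY : 1 < 2 / p + 1 / q).
Hypotheses (r1 : 1 < r) (rpq : 1 / r = 1 / p + 1 / q).
Hypotheses (T0 : 0 < T) (rie : RIE p T S Q).

Let a := p^-1.
Let b := q^-1.
Let X i s := S s 0 i.

Let p0 : 0 < p. Proof. exact: lt_trans p2. Qed.
Let q0 : 0 < q. Proof. exact: lt_le_trans pq. Qed.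
Let a0 : 0 < a. Proof. by rewrite invr_gt0. Qed.
Let b0 : 0 < b. Proof. by rewrite invr_gt0. Qed.
Let ba : b <= a. Proof. by rewrite lef_pV2 ?posrE. Qed.
Let aE : 2 / p = a + a. Proof. by rewrite mulr_natl mulr2n. Qed.
Let aa1 : a + a < 1. Proof. by rewrite -aE ltr_pdivrMr// mul1r. Qed.
Let th1 : 1 < b + (a + a).
Proof. by rewrite -aE addrC; move: pqY; rewrite div1r. Qed.
Let b1 : b < 1. Proof. by move: ba aa1 a0; lra. Qed.
Let rE : r^-1 = a + b. Proof. by move: rpq; rewrite !div1r. Qed.
Let aa0 : 0 < a + a. Proof. exact: addr_gt0. Qed.

Let Xs i : small_path T a (X i). Proof. exact: (path_small p2 T0 rie i). Qed.
Let As j k : small T (a + a) (fun s _ t => area S Q s t j k).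
Proof. by rewrite -aE; exact: (area_small p2 T0 rie j k). Qed.

Let Achen s u t j k : area S Q s t j k - area S Q s u j k - area S Q u t j k =
  (X j u - X j s) * (X k t - X k u).
Proof. exact: (chen S Q s u t j k). Qed.

Lemma controlled_ctrl (F : R -> 'rV[R]_d) DF i : controlled q r T S F DF ->
  ctrl T a b X (fun s => F s 0 i) (fun j s => DF s i j).
Proof.
move=> [Fc DFc DFq FRr].
have DFs j : small_path T b (fun s => DF s i j).
  have h := @pvar_small R T _ _ q (incr DF) i j q0 _ DFq.
  have {}h := h (fun s => subrr (DF s)).
  apply: (eq_small _ (h _)) => [s u t _ _ _ _|]; first by rewrite /incr !mxE.
  have := uniform_modulus (@entry_continuous R T _ _ DF i j DFc).
  by congr vanishing; apply/funext => s; apply/funext => u; apply/funext => t;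
    rewrite /incr !mxE.
split=> //.
have RE s t : remainder S F DF s t 0 i =
    F t 0 i - F s 0 i - \sum_j DF s i j * (X j t - X j s).
  rewrite /remainder /incr !mxE; congr (_ - _).
  by apply: eq_bigr => j _; rewrite !mxE mulrC.
have r0 : 0 < r by exact: lt_trans r1.
have h := @pvar_small R T _ _ r (remainder S F DF) 0 i r0 _ FRr.
rewrite -rE; apply: (eq_small _ (h _ _)) => [s u t _ _ _ _|s|].
- by rewrite RE.
- by rewrite /remainder /incr !subrr mul0mx subrr.
have h1 := uniform_modulus (@entry_continuous R T _ _ F 0 i Fc).
have h2 : vanishing T (fun s _ t => \sum_j - DF s i j * (X j t - X j s)).
  suff H (l : seq 'I_d) : vanishing T
      (fun s _ t => \sum_(j <- l) - DF s i j * (X j t - X j s)) by exact: H.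
  elim: l => [|j l IH].
    by move=> e e0; exists 1 => // *; rewrite big_nil normr0 ltW.
  have bd := bounded3M (bounded3_cst T (- 1)) (bounded_start (small_path_bounded T0 (DFs j))).
  have := vanishingD (vanishing_bdd bd (Xs j).2) IH.
  by congr vanishing; apply/funext => s; apply/funext => u; apply/funext => t;
    rewrite big_cons mulN1r.
have := vanishingD h1 h2.
congr vanishing; apply/funext => s; apply/funext => u; apply/funext => t.
by rewrite RE; congr (_ + _); rewrite -sumrN; apply: eq_bigr => j _; rewrite mulNr.
Qed.

Lemma young_rs (f g : R -> R) : small_path T b f -> small_path T (a + a) g ->
  [/\ forall t, 0 <= t -> t <= T ->
        psum (fun s v => f s * (g v - g s)) 0 @ mesh_to0 0 t --> rs_int f g t,
      small_path T (a + a) (rs_int f g) &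
      small T (b + (a + a))
        (fun s _ t => rs_int f g t - rs_int f g s - f s * (g t - g s))].
Proof.
move=> fs gs; have [J [JP Js JR]] := young_integral T0 a0 b0 fs gs th1.
have JE t : 0 <= t -> t <= T -> rs_int f g t = J t.
  move=> t0 tT; have PF := mesh_to0_proper t0.
  exact: (cvg_lim (@norm_hausdorff _ _) (JP t t0 tT)).
split=> [t t0 tT||]; first by rewrite JE//; exact: JP.
- apply: (eq_small _ Js) => s u t s0 su ut tT.
  by rewrite !JE// ?(le_trans s0)// ?(le_trans su)// (le_trans ut).
- apply: (eq_small _ JR) => s u t s0 su ut tT.
  by rewrite !JE// ?(le_trans s0)// ?(le_trans su)// (le_trans ut).
Qed.

(** Chen's relation absorbs the products of increments over [0, s] and [s, t]. *)
Lemma bracket_increment s t i j : bracket S Q t i j - bracket S Q s i j =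
  (X i t - X i s) * (X j t - X j s) - area S Q s t i j - area S Q s t j i.
Proof.
have bE u : bracket S Q u i j = (X i u - X i 0) * (X j u - X j 0)
    - (area S Q 0 u i j + area S Q 0 u j i).
  rewrite /bracket; move: (area S Q 0 u) => A.
  by rewrite /tensor /symmx /incr !mxE big_ord1 !mxE /X; field.
rewrite [LHS](congr2 (fun x y => x - y) (bE t) (bE s)).
move: (chen S Q 0 s t i j) (chen S Q 0 s t j i).
rewrite /defect /X; move: (area S Q) => A.
move: (A 0 t i j) (A 0 s i j) (A s t i j) (A 0 t j i) (A 0 s j i) (A s t j i).
move: (S t 0 i) (S s 0 i) (S 0 0 i) (S t 0 j) (S s 0 j) (S 0 0 j).
by move=> *; lra.
Qed.

Lemma bracket_small i j : small_path T (a + a) (fun s => bracket S Q s i j).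
Proof.
have aa0' := ltW aa0.
have := smallB aa0' (smallB aa0' (smallM a0 a0 (Xs i) (Xs j)) (As i j)) (As j i).
by apply: eq_small => s u t _ _ _ _; rewrite bracket_increment.
Qed.

Section Limits.
Variable t : R.
Hypotheses (t0 : 0 < t) (tT : t <= T).

Definition germ_limit (A : R -> R -> R) (x : R) :=
  psum A 0 (cut_part Q n t) @[n --> \oo] --> x.

Lemma germ_limit_unique A x y : germ_limit A x -> germ_limit A y -> x = y.
Proof. exact: (cvg_unique (@norm_hausdorff _ _)). Qed.

Lemma germ_limitD A B x y : germ_limit A x -> germ_limit B y ->
  germ_limit (fun s v => A s v + B s v) (x + y).
Proof.
move=> Ax By; rewrite /germ_limit.
by under eq_fun do rewrite psumD; exact: cvgD.
Qed.

Lemma germ_limitZ k A x : germ_limit A x -> germ_limit (fun s v => k * A s v) (k * x).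
Proof.
move=> Ax; rewrite /germ_limit.
by under eq_fun do rewrite psumZ; exact: cvgZr.
Qed.

Lemma germ_limitB A B x y : germ_limit A x -> germ_limit B y ->
  germ_limit (fun s v => A s v - B s v) (x - y).
Proof.
move=> Ax By; have := germ_limitD Ax (germ_limitZ (k := -1) By).
by rewrite mulN1r; congr germ_limit; apply/funext => s; apply/funext => v; rewrite mulN1r.
Qed.

Lemma germ_limit_sum (I : finType) (A : I -> R -> R -> R) (x : I -> R) :
  (forall i, germ_limit (A i) (x i)) ->
  germ_limit (fun s v => \sum_i A i s v) (\sum_i x i).
Proof.
move=> Ax; rewrite /germ_limit; under eq_fun do rewrite psum_sum.
suff H (l : seq I) : (\sum_(i <- l) psum (A i) 0 (cut_part Q n t)) @[n --> \oo]
    --> \sum_(i <- l) x i by exact: H.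
elim: l => [|i l IH].
  by rewrite big_nil; under eq_fun do rewrite big_nil; exact: cvg_cst.
by rewrite big_cons; under eq_fun do rewrite big_cons; apply: cvgD IH; exact: Ax.
Qed.

Lemma germ_limit_mesh A x : psum A 0 @ mesh_to0 0 t --> x -> germ_limit A x.
Proof. exact: cvg_comp (cut_part_cvg T0 rie t0 tT). Qed.

Lemma germ_limit_small theta A : 1 < theta -> small T theta (fun s _ v => A s v) ->
  germ_limit A 0.
Proof. by move=> th sA; apply: germ_limit_mesh; exact: small_psum_cvg0 th sA (ltW t0) tT. Qed.

Lemma germ_limit_area D j k : small_path T b D ->
  germ_limit (fun s v => D s * area S Q s v j k) 0.
Proof.
by move=> Ds; apply: (area_sum_cvg0 p2 T0 rie j k b0 b1) => //; rewrite aE.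
Qed.

(** Along these partitions the second-order terms drop out, one pair of
coordinates at a time, and left-point sums remain. *)
Lemma ctrl_integral (f g : 'I_d -> R -> R) (f' g' : 'I_d -> 'I_d -> R -> R) :
  (forall i, ctrl T a b X (f i) (f' i)) -> (forall i, ctrl T a b X (g i) (g' i)) ->
  exists2 z, psum (fun s v => \sum_i ctrl_germ (area S Q) (f i) (f' i) (g i) (g' i) s v) 0
    @ mesh_to0 0 t --> z &
  germ_limit (fun s v => \sum_i f i s * (g i v - g i s)) z.
Proof.
move=> fc gc.
pose Xi s v := \sum_i ctrl_germ (area S Q) (f i) (f' i) (g i) (g' i) s v.
have dXi : small T (b + (a + a)) (defect Xi).
  have := small_sum (ltW (lt_trans ltr01 th1))
    (fun i => ctrl_germ_defect T0 a0 b0 Xs As Achen (fc i) (gc i)).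
  by apply: eq_small => s u v _ _ _ _; rewrite /defect /Xi -!sumrB.
have [J [JP _]] := sewing th1 dXi.
have Jt := JP _ (ltW t0) tT; exists (J t); first exact: Jt.
have area0 : germ_limit (fun s v => \sum_i \sum_j \sum_k
    f' i j s * g' i k s * area S Q s v j k) (\sum_(i : 'I_d) \sum_(j : 'I_d) \sum_(k : 'I_d) 0).
  apply: germ_limit_sum => i; apply: germ_limit_sum => j; apply: germ_limit_sum => k.
  apply: (@germ_limit_area (fun s => f' i j s * g' i k s)).
  by apply: small_pathM => //; [exact: ltW|exact: (fc i).1|exact: (gc i).1].
have := germ_limitB (germ_limit_mesh Jt) area0.
rewrite [X in J t - X](_ : _ = 0) ?subr0.
  congr germ_limit; apply/funext => s; apply/funext => v.
  by rewrite /Xi /ctrl_germ big_split /= addrK.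
by rewrite big1// => i _; rewrite big1// => j _; rewrite big1.
Qed.

Lemma rough_integral (G : R -> 'rV[R]_d) (DG : R -> 'M[R]_d) :
  (forall i, ctrl T a b X (fun s => G s 0 i) (fun j s => DG s i j)) ->
  germ_limit (fun s v => \sum_i G s 0 i * (X i v - X i s)) (rough_int S Q G DG t).
Proof.
move=> Gc; have [z + zl] := ctrl_integral Gc (ctrl_coord T a b X).
suff -> : (fun s v => \sum_i ctrl_germ (area S Q) (fun s => G s 0 i)
      (fun j s => DG s i j) (X i) (fun j _ => (i == j)%:R) s v) =
    (fun s v => dotp (G s) (incr S s v) + \sum_i \sum_j DG s i j * area S Q s v j i).
  move=> zP; suff -> : rough_int S Q G DG t = z by [].
  have PF := mesh_to0_proper (ltW t0); exact: (cvg_lim (@norm_hausdorff _ _) zP).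
apply/funext => s; apply/funext => v.
rewrite /dotp -big_split; apply: eq_bigr => i _; rewrite /ctrl_germ /incr !mxE.
congr (_ + _); apply: eq_bigr => j _.
rewrite (bigD1 i)//= eqxx mulr1 big1 ?addr0// => k ki.
by rewrite eq_sym (negPf ki) mulr0 mul0r.
Qed.

Lemma controlled_integral (G M : R -> 'rV[R]_d) (DG DM : R -> 'M[R]_d) :
  (forall i, ctrl T a b X (fun s => G s 0 i) (fun j s => DG s i j)) ->
  (forall i, ctrl T a b X (fun s => M s 0 i) (fun j s => DM s i j)) ->
  cvg (controlled_sum S Q G DG M DM @ mesh_to0 0 t) /\
  germ_limit (fun s v => \sum_i G s 0 i * (M v 0 i - M s 0 i))
    (controlled_int S Q G DG M DM t).
Proof.
move=> Gc Mc; have [z + zl] := ctrl_integral Gc Mc.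
suff -> : (fun s v => \sum_i ctrl_germ (area S Q) (fun s => G s 0 i)
      (fun j s => DG s i j) (fun s => M s 0 i) (fun j s => DM s i j) s v) =
    (fun s v => dotp (G s) (incr M s v)
      + \sum_i \sum_j \sum_k DG s i j * DM s i k * area S Q s v j k).
  move=> zP; split; first by apply/cvg_ex; exists z.
  suff -> : controlled_int S Q G DG M DM t = z by [].
  have PF := mesh_to0_proper (ltW t0); exact: (cvg_lim (@norm_hausdorff _ _) zP).
apply/funext => s; apply/funext => v.
by rewrite /dotp -big_split; apply: eq_bigr => i _; rewrite /ctrl_germ /incr !mxE.
Qed.

Lemma rs_limit (f g : R -> R) : small_path T b f -> small_path T (a + a) g ->
  germ_limit (fun s v => f s * (g v - g s)) (rs_int f g t).
Proof.
by move=> fs gs; have [JP _ _] := young_rs fs gs; apply: germ_limit_mesh; exact: JP (ltW t0) tT.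
Qed.

Lemma area_term_null (f : R -> R) i j : small_path T b f ->
  germ_limit (fun s v => f s * (area S Q s v i j + area S Q s v j i)) 0.
Proof.
move=> fs; have := germ_limitD (germ_limit_area i j fs) (germ_limit_area j i fs).
rewrite addr0; congr germ_limit; apply/funext => s; apply/funext => v; ring.
Qed.

(** The areas in bracket_increment do not contribute along these partitions, which
makes the bracket a quadratic covariation. *)
Lemma rs_bracket_limit (f : R -> R) i j : small_path T b f ->
  germ_limit (fun s v => f s * ((X i v - X i s) * (X j v - X j s)))
    (rs_int f (fun s => bracket S Q s i j) t).
Proof.
move=> fs.
have := germ_limitD (rs_limit fs (bracket_small i j)) (area_term_null i j fs).
rewrite addr0; congr germ_limit; apply/funext => s; apply/funext => v.
rewrite bracket_increment; ring.
Qed.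

End Limits.

(** * Relative wealth *)

Section Market.
Hypothesis Sp : forall s i, 0 <= s -> 0 < S s 0 i.
Variable i0 : 'I_d.

Let mu s := market (S s).
Let tot s := capital (S s).

Lemma path_lower i : exists2 m, 0 < m & forall s, 0 <= s -> s <= T -> m <= X i s.
Proof.
have [Sc _ _ _ _] := rie.
apply: positive_bounded; first exact: entry_continuous.
by move=> s s0 _; exact: Sp.
Qed.

Lemma path_le_capital s i : 0 <= s -> X i s <= tot s.
Proof.
move=> s0; rewrite /tot /capital (bigD1 i)//= lerDl sumr_ge0// => j _.
exact/ltW/Sp.
Qed.

Lemma capital_gt0 s : 0 <= s -> 0 < tot s.
Proof. by move=> s0; apply: lt_le_trans (path_le_capital i0 s0); exact: Sp. Qed.

Lemma capital_lower : exists2 m, 0 < m & forall s, 0 <= s -> s <= T -> m <= tot s.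
Proof.
have [m m0 mP] := path_lower i0; exists m => // s s0 sT.
exact: le_trans (mP s s0 sT) (path_le_capital i0 s0).
Qed.

Lemma ctrl_capital : ctrl T a b X tot (fun j _ => \sum_i (i == j)%:R).
Proof. exact: (ctrl_sum a0 b0 (fun i => ctrl_coord T a b X i)). Qed.

Lemma ctrl_inv_path i : ctrl T a b X (fun s => cinv (S s) 0 i)
  (fun j s => Dmx (fun x => cinv x) (S s) i j).
Proof.
have [m m0 mP] := path_lower i.
have := ctrlV T0 a0 b0 ba Xs m0 mP (ctrl_coord T a b X i).
apply: eq_ctrl => [s s0 sT|j s s0 sT]; first by rewrite mxE.
by rewrite Dmx_inv// => k; rewrite gt_eqF// Sp.
Qed.

Lemma ctrl_market i : ctrl T a b X (fun s => mu s 0 i)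
  (fun j s => Dmx (@market R d) (S s) i j).
Proof.
have [m m0 mP] := capital_lower.
have := ctrlM T0 a0 b0 ba Xs (ctrl_coord T a b X i)
  (ctrlV T0 a0 b0 ba Xs m0 mP ctrl_capital).
apply: eq_ctrl => [s s0 sT|j s s0 sT]; first by rewrite /mu marketE.
by rewrite Dmx_market// gt_eqF// capital_gt0.
Qed.

Lemma ctrl_inv_market i : ctrl T a b X (fun s => cinv (mu s) 0 i)
  (fun j s => Dmx (fun x => cinv (market x)) (S s) i j).
Proof.
have [m m0 mP] := path_lower i.
have := ctrlM T0 a0 b0 ba Xs ctrl_capital
  (ctrlV T0 a0 b0 ba Xs m0 mP (ctrl_coord T a b X i)).
apply: eq_ctrl => [s s0 sT|j s s0 sT].
  by rewrite !mxE invfM invrK.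
have c0 : capital (S s) != 0 by rewrite gt_eqF// capital_gt0.
by rewrite Dmx_inv_market// => k; rewrite gt_eqF// Sp.
Qed.

Lemma ctrl_cmul (F G : R -> 'rV[R]_d) (DF DG : R -> 'M[R]_d) :
  (forall i, ctrl T a b X (fun s => F s 0 i) (fun j s => DF s i j)) ->
  (forall i, ctrl T a b X (fun s => G s 0 i) (fun j s => DG s i j)) ->
  forall i, ctrl T a b X (fun s => cmul (F s) (G s) 0 i)
    (fun j s => cmul' F DF G DG s i j).
Proof.
move=> Fc Gc i; apply: eq_ctrl (ctrlM T0 a0 b0 ba Xs (Fc i) (Gc i)) => [s _ _|j s _ _];
  by rewrite !mxE.
Qed.

Section Wealth.
Variable t : R.
Hypotheses (t0 : 0 < t) (tT : t <= T).
Let limit := germ_limit t.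

(** The limit does not involve DF: this is the independence of the Gubinelli
derivative. *)
Lemma log_wealth_limit (F : R -> 'rV[R]_d) DF : controlled q r T S F DF ->
  limit (fun s v => \sum_i F s 0 i * (S s 0 i)^-1 * (X i v - X i s)
    - 2^-1 * \sum_i \sum_j F s 0 i * F s 0 j / (S s 0 i * S s 0 j)
        * ((X i v - X i s) * (X j v - X j s))) (ln (wealth S Q F DF t)).
Proof.
move=> Fcon; rewrite /wealth expRK.
have Fc i := controlled_ctrl i Fcon.
apply: germ_limitB.
  have := rough_integral t0 tT (ctrl_cmul Fc ctrl_inv_path).
  congr germ_limit; apply/funext => s; apply/funext => v.
  by apply: eq_bigr => i _; rewrite !mxE.
apply: germ_limitZ; apply: germ_limit_sum => i; apply: germ_limit_sum => j.
apply: (rs_bracket_limit t0 tT).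
have low k : small_path T b (fun s => F s 0 k) by exact: ctrl_small_low (Fc k).
have ilow k : small_path T b (fun s => cinv (S s) 0 k).
  exact: ctrl_small_low (ctrl_inv_path k).
have b0' := ltW b0.
have := small_pathM T0 b0' (small_pathM T0 b0' (low i) (low j))
  (small_pathM T0 b0' (ilow i) (ilow j)).
by apply: eq_small => s u v _ _ _ _; rewrite !mxE !invfM.
Qed.

(** Associativity of the Young integral, together with the fact that the bracket
is a quadratic covariation, turns integrals against the relative covariances
into limits of sums of squares. *)
Lemma relative_covariance_limit (F : R -> 'rV[R]_d) DF i j :
  controlled q r T S F DF ->
  limit (fun s v => F s 0 i * F s 0 j * \sum_k \sum_l
      ((mu s - delta_mx 0 i) 0 k * (mu s - delta_mx 0 j) 0 l)
      * (S s 0 k * S s 0 l)^-1 * ((X k v - X k s) * (X l v - X l s)))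
    (rs_int (fun s => F s 0 i * F s 0 j) (rel_cov S Q mu i j) t).
Proof.
move=> Fcon; have b0' := ltW b0; have aa0' := ltW aa0.
have th0 : 0 <= b + (a + a) by rewrite addr_ge0.
have Flow k : small_path T b (fun s => F s 0 k).
  exact: ctrl_small_low (controlled_ctrl k Fcon).
have Fs : small_path T b (fun s => F s 0 i * F s 0 j) by exact: small_pathM.
pose f k l s := (mu s - delta_mx 0 i) 0 k * (mu s - delta_mx 0 j) 0 l.
pose g k l s := (S s 0 k * S s 0 l)^-1.
have mulow (i' k : 'I_d) : small_path T b (fun s => (mu s - delta_mx 0 i') 0 k).
  have mus : small_path T b (fun s => mu s 0 k) by exact: ctrl_small_low (ctrl_market k).
  apply: (eq_small _ mus) => s u v _ _ _ _.
  by rewrite !mxE; ring.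
have fs k l : small_path T b (f k l) by exact: small_pathM.
have gs k l : small_path T b (g k l).
  have low k' : small_path T b (fun s => cinv (S s) 0 k').
    exact: ctrl_small_low (ctrl_inv_path k').
  apply: (eq_small _ (small_pathM T0 b0' (low k) (low l))) => s u v _ _ _ _.
  by rewrite /g !mxE !invfM.
have cov_young k l := young_rs (gs k l) (bracket_small k l).
have covs k l : small_path T (a + a) (cov S Q k l) by case: (cov_young k l).
have rel_young k l := young_rs (fs k l) (covs k l).
have rels : small_path T (a + a) (rel_cov S Q mu i j).
  by apply: small_path_sum => // k; apply: small_path_sum => // l; case: (rel_young k l).
have fb k l := bounded_start (small_path_bounded T0 (fs k l)).
have err k l : small T (b + (a + a)) (fun s _ v =>
    rs_int (f k l) (cov S Q k l) v - rs_int (f k l) (cov S Q k l) s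
    - f k l s * g k l s * (bracket S Q v k l - bracket S Q s k l)).
  have [_ _ h1] := rel_young k l; have [_ _ h2] := cov_young k l.
  have := smallD th0 h1 (small_bdd (fb k l) h2).
  have telescope (I1 I2 c1 c2 z1 z2 x y : R) : I1 - I2 - x * (c1 - c2)
      + x * (c1 - c2 - y * (z1 - z2)) = I1 - I2 - x * y * (z1 - z2) by ring.
  by apply: eq_small => s u v _ _ _ _; exact: telescope.
have err_sum := small_bdd (bounded_start (small_path_bounded T0 Fs))
  (small_sum th0 (fun k => small_sum th0 (err k))).
have area_null : limit (fun s v => \sum_k \sum_l (F s 0 i * F s 0 j * (f k l s * g k l s))
    * (area S Q s v k l + area S Q s v l k)) (\sum_(k : 'I_d) \sum_(l : 'I_d) 0).
  apply: germ_limit_sum => k; apply: germ_limit_sum => l.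
  apply: (area_term_null t0 tT k l
    (f := fun s => F s 0 i * F s 0 j * (f k l s * g k l s))).
  exact: small_pathM (small_pathM _ _ _ _).
have := germ_limitD (germ_limitB (rs_limit t0 tT Fs rels)
  (germ_limit_small t0 tT th1 err_sum)) area_null.
rewrite subr0 [X in _ + X]big1 ?addr0; last by move=> k _; rewrite big1.
congr germ_limit; apply/funext => s; apply/funext => v.
rewrite -mulrBr -[X in _ + X](_ : F s 0 i * F s 0 j * \sum_k \sum_l f k l s * g k l s
    * (area S Q s v k l + area S Q s v l k) = _); last first.
  rewrite mulr_sumr; apply: eq_bigr => k _; rewrite mulr_sumr; apply: eq_bigr => l _.
  by rewrite mulrA.
rewrite -mulrDr; congr (_ * _).
rewrite /rel_cov -!sumrB -big_split; apply: eq_bigr => k _.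
rewrite -!sumrB -big_split; apply: eq_bigr => l _ /=.
have := bracket_increment s v k l.
rewrite -/(f k l) -/(f k l s) -/(g k l s).
move: (rs_int _ _ v) (rs_int _ _ s) (bracket _ _ v _ _ - bracket _ _ s _ _).
move: (area _ _ _ _ k l) (area _ _ _ _ l k).
by move=> x y I1 I2 B ->; ring.
Qed.

(** The local identity behind the theorem.  Here y_i = h_i / x_i are the relative
increments, A = \sum_i pi_i y_i, m = \sum_i h_i / \sum_i x_i, and rho = 1 / (1 + m)
is the quotient of the total capitals; all terms up to order two cancel. *)
Lemma relative_wealth_germ (F : R -> 'rV[R]_d) s v : 0 <= s -> 0 <= v ->
  \sum_i F s 0 i = 1 ->
  let h i := X i v - X i s in
  (\sum_i F s 0 i * (S s 0 i)^-1 * h i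
     - 2^-1 * \sum_i \sum_j F s 0 i * F s 0 j / (S s 0 i * S s 0 j) * (h i * h j))
  - (\sum_i mu s 0 i * (S s 0 i)^-1 * h i
     - 2^-1 * \sum_i \sum_j mu s 0 i * mu s 0 j / (S s 0 i * S s 0 j) * (h i * h j))
  - (\sum_i cmul (F s) (cinv (mu s)) 0 i * (mu v 0 i - mu s 0 i)
     - 2^-1 * \sum_i \sum_j F s 0 i * F s 0 j * \sum_k \sum_l
        ((mu s - delta_mx 0 i) 0 k * (mu s - delta_mx 0 j) 0 l)
        * (S s 0 k * S s 0 l)^-1 * (h k * h l))
  = - (tot s * (tot v)^-1) *
    ((\sum_i F s 0 i * (S s 0 i)^-1 * h i - \sum_i (tot s)^-1 * h i) *
      ((\sum_i (tot s)^-1 * h i) * (\sum_i (tot s)^-1 * h i))).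
Proof.
move=> s0 v0 F1 h.
have Sn0 u i : 0 <= u -> S u 0 i != 0 by move=> u0; rewrite gt_eqF// Sp.
have tn0 u : 0 <= u -> tot u != 0 by move=> u0; rewrite gt_eqF// capital_gt0.
set A := \sum_i F s 0 i * (S s 0 i)^-1 * h i.
set m := \sum_i (tot s)^-1 * h i.
have square (c : 'I_d -> R) : \sum_i \sum_j c i * c j = (\sum_i c i) * (\sum_i c i).
  by rewrite big_distrlr.
have mE : \sum_i mu s 0 i * (S s 0 i)^-1 * h i = m.
  apply: eq_bigr => i _; rewrite /mu marketE -/(tot s); congr (_ * _).
  by rewrite mulrAC divff ?mul1r// Sn0.
have FF : \sum_i \sum_j F s 0 i * F s 0 j / (S s 0 i * S s 0 j) * (h i * h j) = A * A.
  rewrite -square; apply: eq_bigr => i _; apply: eq_bigr => j _; rewrite invfM; ring.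
have MM : \sum_i \sum_j mu s 0 i * mu s 0 j / (S s 0 i * S s 0 j) * (h i * h j) = m * m.
  rewrite -mE -square; apply: eq_bigr => i _; apply: eq_bigr => j _; rewrite invfM; ring.
have WW : \sum_i \sum_j F s 0 i * F s 0 j * \sum_k \sum_l
    ((mu s - delta_mx 0 i) 0 k * (mu s - delta_mx 0 j) 0 l)
    * (S s 0 k * S s 0 l)^-1 * (h k * h l) = (m - A) * (m - A).
  have D i : \sum_k (mu s - delta_mx 0 i) 0 k * (S s 0 k)^-1 * h k
      = m - (S s 0 i)^-1 * h i.
    rewrite -mE (eq_bigr (fun k => mu s 0 k * (S s 0 k)^-1 * h k
        - (i == k)%:R * ((S s 0 k)^-1 * h k))).
      rewrite sumrB; congr (_ - _); rewrite (bigD1 i)//= eqxx mul1r big1 ?addr0// => k ki.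
      by rewrite eq_sym (negPf ki) mul0r.
    by move=> k _; rewrite !mxE eqxx [k == i]eq_sym /=; ring.
  have E : m - A = \sum_i F s 0 i * \sum_k (mu s - delta_mx 0 i) 0 k * (S s 0 k)^-1 * h k.
    rewrite (eq_bigr (fun i => F s 0 i * m - F s 0 i * (S s 0 i)^-1 * h i)).
      by rewrite sumrB -mulr_suml F1 mul1r.
    by move=> i _; rewrite D; ring.
  rewrite E -square; apply: eq_bigr => i _; apply: eq_bigr => j _.
  rewrite mulrACA big_distrlr /=; congr (_ * _).
  by apply: eq_bigr => k _; apply: eq_bigr => l _; rewrite invfM; ring.
set rho := tot s * (tot v)^-1.
have totvE : tot v = tot s * (1 + m).
  rewrite mulrDr mulr1 /m -mulr_sumr mulrA divff ?tn0// mul1r /h sumrB.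
  by rewrite /tot /capital addrC subrK.
have m1 : 1 + m != 0.
  by apply/eqP => m1; move: (tn0 v v0); rewrite totvE m1 mulr0 eqxx.
have rhoE : rho = (1 + m)^-1.
  by rewrite /rho totvE invfM mulrA divff ?tn0// mul1r.
have GG : \sum_i cmul (F s) (cinv (mu s)) 0 i * (mu v 0 i - mu s 0 i) = rho * (A - m).
  have -> : rho * (A - m) = \sum_i (F s 0 i * (rho - 1)
      + rho * (F s 0 i * (S s 0 i)^-1 * h i)).
    rewrite big_split /= -mulr_suml F1 mul1r -mulr_sumr -/A rhoE; field.
    by [].
  apply: eq_bigr => i _; rewrite !mxE /rho /h /X -/(capital _) -/(capital _) -/(tot s) -/(tot v).
  by field; rewrite !tn0// !Sn0.
rewrite mE FF MM WW GG rhoE; field.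
by [].
Qed.

(** A product of three increments is of order 3/p; this exceeds one because
q >= p. *)
Lemma third_order_small (F : R -> 'rV[R]_d) DF : controlled q r T S F DF ->
  small T (a + (a + a)) (fun s _ v => - (tot s * (tot v)^-1) *
    ((\sum_i F s 0 i * (S s 0 i)^-1 * (X i v - X i s)
      - \sum_i (tot s)^-1 * (X i v - X i s)) *
     ((\sum_i (tot s)^-1 * (X i v - X i s)) * (\sum_i (tot s)^-1 * (X i v - X i s))))).
Proof.
move=> Fcon; have a0' := ltW a0.
have [m m0 mP] := capital_lower.
have tV := inv_bounded m0 mP.
have tb := ctrl_bounded T0 a0 b0 Xs ctrl_capital.
have rel : small T a (fun s _ v => \sum_i (tot s)^-1 * (X i v - X i s)).
  by apply: small_sum => // i; exact: small_bdd (bounded_start tV) (Xs i).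
have port : small T a (fun s _ v => \sum_i F s 0 i * (S s 0 i)^-1 * (X i v - X i s)).
  apply: small_sum => // i; apply: small_bdd (Xs i); apply: bounded3M.
    exact/bounded_start/(ctrl_bounded T0 a0 b0 Xs (controlled_ctrl i Fcon)).
  have [mi mi0 miP] := path_lower i.
  exact/bounded_start/(inv_bounded mi0 miP).
have ratio : bounded3 T (fun s _ v => - (tot s * (tot v)^-1)).
  have [C CP] := bounded3M (bounded_start tb) (bounded_end tV).
  by exists C => s u v *; rewrite normrN (CP s u v).
exact: small_bdd ratio (smallM a0 aa0 (smallB a0' port rel) (smallM a0 a0 rel rel)).
Qed.

Lemma relative_wealth_pos (F : R -> 'rV[R]_d) F1 F2 M1 :
  (forall s, 0 <= s -> \sum_i F s 0 i = 1) ->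
  controlled q r T S F F1 -> controlled q r T S F F2 -> controlled q r T S mu M1 ->
  let mu' := fun s => Dmx (@market R d) (S s) in
  let F_mu := fun s => cmul (F s) (cinv (mu s)) in
  let F_mu' := cdiv' S F F2 (@market R d) in
  cvg (controlled_sum S Q F_mu F_mu' mu mu' @ mesh_to0 0 t) /\
  ln (wealth S Q F F1 t / wealth S Q mu M1 t) =
    controlled_int S Q F_mu F_mu' mu mu' t
    - 2^-1 * \sum_i \sum_j
        rs_int (fun s => F s 0 i * F s 0 j) (rel_cov S Q mu i j) t.
Proof.
move=> F1s hF1 hF2 hM1 mu' F_mu F_mu'.
have F_muc := ctrl_cmul (fun i => controlled_ctrl i hF2) ctrl_inv_market.
have [cv lim3] := controlled_integral t0 tT F_muc ctrl_market.
split; first exact: cv.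
have W0 G DG : 0 < wealth S Q G DG t by exact: expR_gt0.
rewrite ln_div ?posrE//.
have lim1 := log_wealth_limit hF1; have lim2 := log_wealth_limit hM1.
have lim4 := germ_limitZ (k := 2^-1) (germ_limit_sum (fun i => germ_limit_sum (fun j =>
  relative_covariance_limit (i := i) (j := j) hF1))).
have lim := germ_limitB (germ_limitB lim1 lim2) (germ_limitB lim3 lim4).
have aaa1 : 1 < a + (a + a) by apply: lt_le_trans th1 _; rewrite lerD2r.
have small0 : small T (a + (a + a)) (fun s _ v => _) := third_order_small hF1.
have lim0 : limit _ 0 := germ_limit_small t0 tT aaa1
  (eq_small (fun s u v (s0 : 0 <= s) (su : s <= u) (uv : u <= v) _ =>
    esym (relative_wealth_germ s0 (le_trans (le_trans s0 su) uv) (F1s s s0))) small0).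
exact: subr0_eq (germ_limit_unique lim lim0).
Qed.

End Wealth.
End Market.
End Integrals.

(** At time zero the only partition is the empty list. *)
Lemma psum_mesh_to00 (R : realType) (A : R -> R -> R) :
  psum A 0 @ mesh_to0 0 0 --> (0 : R).
Proof.
apply/mesh_to0_cvgP => e e0; exists 1 => // l /itv_partitionxx -> _.
by rewrite psum_nil subrr normr0 ltW.
Qed.

Lemma psum_lim00 (R : realType) (A : R -> R -> R) : lim (psum A 0 @ mesh_to0 0 0) = 0 :> R.
Proof.
have PF := mesh_to0_proper (lexx (0 : R)).
exact: (cvg_lim (@norm_hausdorff _ _) (psum_mesh_to00 A)).
Qed.

Theorem proposition3p9 (R : realType) (d : nat) (p q r : R)
  (hp2 : 2 < p) (hp3 : p < 3) (hpq : p <= q) (hr : 1 < r)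
  (hYoung : 1 < 2 / p + 1 / q) (hrpq : 1 / r = 1 / p + 1 / q)
  (S : R -> 'rV[R]_d) (P : nat -> nat -> R) (hS : price_path p S P)
  (F : R -> 'rV[R]_d) (hF : portfolio q r S F)
  (t T : R) (ht : 0 <= t) (hT : 0 < T) (htT : t <= T)
  (F1 F2 M1 : R -> 'M[R]_d)
  (hF1 : controlled q r T S F F1) (hF2 : controlled q r T S F F2)
  (hM1 : controlled q r T S (fun s => market (S s)) M1) :
  let Q := fun n => restrict_part (P n) T in
  let mu := fun s => market (S s) in
  let mu' := fun s => Dmx (@market R d) (S s) in
  let F_mu := fun s => cmul (F s) (cinv (mu s)) in
  let F_mu' := cdiv' S F F2 (@market R d) in
  cvg (controlled_sum S Q F_mu F_mu' mu mu' @ mesh_to0 0 t) /\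
  ln (wealth S Q F F1 t / wealth S Q mu M1 t) =
    controlled_int S Q F_mu F_mu' mu mu' t
    - 2^-1 * \sum_i \sum_j
        rs_int (fun s => F s 0 i * F s 0 j) (rel_cov S Q mu i j) t.
Proof.
move=> Q mu mu' F_mu F_mu'.
have [_ Sp _ _ rieS] := hS; have rie := rieS T hT.
have F_sum s : 0 <= s -> \sum_i F s 0 i = 1 by case: hF => + _ => /[apply].
move: ht; rewrite le_eqVlt => /predU1P[t0|t0]; last first.
  (* For d = 0 the weights of a portfolio could not sum up to one. *)
  have [i0|no_i] := pickP (fun _ : 'I_d => true).
    move=> _; exact: (relative_wealth_pos hp2 hpq hYoung hr hrpq hT rie
      (fun s i s0 => Sp s i s0) i0 t0 htT F_sum hF1 hF2 hM1).
  have := F_sum 0 (lexx 0); rewrite big_pred0 => [/eqP|i].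
    by rewrite eq_sym oner_eq0.
  by have := no_i i.
rewrite -t0; split; first by apply/cvg_ex; exists 0; exact: psum_mesh_to00.
have rs0 f g : rs_int f g 0 = 0 :> R by exact: psum_lim00.
have W1 G DG : wealth S Q G DG 0 = 1.
  rewrite /wealth [rough_int _ _ _ _ _]psum_lim00 big1 ?mulr0 ?subrr ?expR0//.
  by move=> i _; rewrite big1.
rewrite !W1 divr1 ln1 [controlled_int _ _ _ _ _ _ _]psum_lim00 big1 ?mulr0 ?subrr//.
by move=> i _; rewrite big1.
Qed.
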